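(* Let $J\ge 1$ be an integer, $\lambda>0$, $\mu_i>0$ and $z_i>0$ for $i=1,\dots,J$, and assume $c>0$. For $i=1,\dots,J$ let $\beta_i$ be the unique positive solution of $$c+\lambda(1-e^{\beta_i})+\mu_i(1-e^{-\beta_i})=0,$$ and set $b_i=\beta_i\sum_{j=1}^i e_j\in\mathbb{R}^J$, where $e_1,\dots,e_J$ are the unit coordinate vectors. Let $z=(z_1,\dots,z_J)$. Then the viscosity solution (i.e. the unique Lipschitz viscosity solution, in the sense defined in the context) of the PDE $$\begin{cases} H(DV(x))=0, & x\in G^o,\\ DV(x)\cdot\gamma_i=0, & i\in I(x),\ x\in\partial_+G,\\ V(x)=0, & x\in\partial_oG,\end{cases}$$ is given by $$V(x)=\min_{i=1,\dots,J} b_i\cdot(z-x).$$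
   Context: Vectors: $e_1,\dots,e_J$ are the unit coordinate vectors of $\mathbb{R}^J$; $\gamma_i=e_i-e_{i+1}$ for $i=1,\dots,J-1$ and $\gamma_J=e_J$. The scalar product is denoted by $\cdot$, maximum by $\vee$, minimum by $\wedge$. Domain: $G=\{(x_1,\dots,x_J): 0\le x_1<z_1;\ 0\le x_i\le z_i,\ i=2,\dots,J\}$, with closure $\bar G$, boundary $\partial G$ and interior $G^o=G\setminus\partial G$. The boundary is partitioned into - $\partial_cG=\{x: 0\le x_1<z_1,\ 0\le x_i\le z_i \text{ for all } i>1, \text{ and } x_i=z_i \text{ for some } i>1\}$, - $\partial_oG=\{x: x_1=z_1 \text{ and } 0\le x_i\le z_i \text{ for all } i>1\}$, - $\partial_+G=\{x: 0\le x_i<z_i \text{ for all } i, \text{ and } x_i=0 \text{ for some } i\}$. For $x\in G$, $I(x)=\{i\in\{1,\dots,J\}: x_i=0\}$. Hamiltonian: let $l(x)=x\log x-x+1$ for $x\ge0$ (with $0\log 0=0$) and $l(x)=+\infty$ for $x<0$. Let $U=[0,1]^J$ and $M=\{m=(\bar\lambda,\bar\mu_1,\dots,\bar\mu_J): \bar\lambda\ge0,\ \bar\mu_i\ge0\}$. For $p\in\mathbb{R}^J$, $u\in U$, $m\in M$, $$H(p,u,m)=c+\Big[\bar\lambda p_1+\lambda\, l\big(\tfrac{\bar\lambda}{\lambda}\big)\Big]+\sum_{i=1}^J u_i\Big[-\bar\mu_i\,\gamma_i\cdot p+\mu_i\, l\big(\tfrac{\bar\mu_i}{\mu_i}\big)\Big],$$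 and $$H(p)=\sup_{u\in U}\inf_{m\in M}H(p,u,m),$$ which equals $c+\lambda(1-e^{-p_1})+\sum_{i=1}^J 0\vee \mu_i(1-e^{\gamma_i\cdot p})$. Viscosity solutions: for a continuous function $V$ on $\bar G$ and $x\in G$, $$D^+V(x)=\Big\{p:\limsup_{y\to x}\frac{V(y)-V(x)-p\cdot(y-x)}{|y-x|}\le0\Big\},\qquad D^-V(x)=\Big\{p:\liminf_{y\to x}\frac{V(y)-V(x)-p\cdot(y-x)}{|y-x|}\ge0\Big\},$$ where $y$ ranges over the domain of $V$. $V$ is a viscosity solution of the PDE if - $H(p)\vee\max_{i\in I(x)}p\cdot\gamma_i\ge0$ for all $p\in D^+V(x)$, $x\in G$; - $H(p)\wedge\min_{i\in I(x)}p\cdot\gamma_i\le0$ for all $p\in D^-V(x)$, $x\in G\setminus\partial_cG$; - $V(x)=0$ for $x\in\partial_oG$. When $I(x)=\emptyset$ the max and min terms are omitted. It is known from earlier work (Atar, Dupuis, Shwartz) that there exists a unique Lipschitz viscosity solution; ''the viscosity solution'' refers to it. *)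

(* Defs.v *)
(* MathComp / MathComp-Analysis.

   The dimension J >= 1 is written n.+1, and the indices 1, ..., J are the
   ordinals 'I_n.+1, so that the first coordinate is x 0 ord0. *)
From HB Require Import structures.
From mathcomp Require Import all_boot all_order all_algebra.
From mathcomp Require Import all_classical all_reals all_analysis.
Set Implicit Arguments.
Unset Strict Implicit.
Unset Printing Implicit Defensive.
Import Order.TTheory GRing.Theory Num.Theory.
Import numFieldNormedType.Exports.
Local Open Scope classical_set_scope.
Local Open Scope ring_scope.

Section Vectors.
Context {R : realType} {n : nat}.
Implicit Types (p q : 'rV[R]_n.+1) (i : 'I_n.+1).

Definition dotp p q : R := \sum_i p 0 i * q 0 i.

(* The library norm on row vectors is the sup norm. *)
Definition enorm p : R := Num.sqrt (dotp p p).

Definition unitv i : 'rV[R]_n.+1 := delta_mx 0 i.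

Definition gamma i : 'rV[R]_n.+1 :=
  if (i < n)%N then unitv i - unitv (inord i.+1) else unitv i.

End Vectors.

Section Domain.
Context {R : realType} {n : nat}.
Implicit Types z x : 'rV[R]_n.+1.

Definition domG z : set 'rV[R]_n.+1 :=
  [set x | 0 <= x 0 ord0 < z 0 ord0 /\
           forall i, i != ord0 -> 0 <= x 0 i <= z 0 i].

Definition boundary_c z : set 'rV[R]_n.+1 :=
  [set x | [/\ 0 <= x 0 ord0 < z 0 ord0,
               forall i, i != ord0 -> 0 <= x 0 i <= z 0 i &
               exists2 i, i != ord0 & x 0 i = z 0 i]].

Definition boundary_o z : set 'rV[R]_n.+1 :=
  [set x | x 0 ord0 = z 0 ord0 /\
           forall i, i != ord0 -> 0 <= x 0 i <= z 0 i].

Definition Iset x : {pred 'I_n.+1} := [pred i | x 0 i == 0].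

End Domain.

Section Hamiltonian.
Context {R : realType} {n : nat}.
Variables (lam c : R) (mu : 'I_n.+1 -> R).
Local Open Scope ereal_scope.

(* [ln 0 = 0] in the library, hence [ell 0 = 1]. *)
Definition ell (x : R) : \bar R :=
  if (0 <= x)%R then (x * ln x - x + 1)%R%:E else +oo.

Definition Uset : set ('I_n.+1 -> R) := [set u | forall i, (0 <= u i <= 1)%R].

Definition Mset : set (R * ('I_n.+1 -> R)) :=
  [set m | (0 <= m.1)%R /\ forall i, (0 <= m.2 i)%R].

Definition Ham3 (p : 'rV[R]_n.+1) (u : 'I_n.+1 -> R)
    (m : R * ('I_n.+1 -> R)) : \bar R :=
  c%:E + ((m.1 * p 0%R ord0)%R%:E + lam%:E * ell (m.1 / lam)%R)
  + \sum_i (u i)%:E *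
      ((- m.2 i * dotp (gamma i) p)%R%:E + (mu i)%:E * ell (m.2 i / mu i)%R).

Definition Ham (p : 'rV[R]_n.+1) : \bar R :=
  ereal_sup [set ereal_inf [set Ham3 p u m | m in Mset] | u in Uset].

End Hamiltonian.

Section Viscosity.
Context {R : realType} {n : nat}.
Variables (lam c : R) (mu : 'I_n.+1 -> R) (z : 'rV[R]_n.+1).
Local Notation Gbar := (closure (domG z)).

(* A function on the closure of G is encoded as a total function of which only
   the values on that closure are ever used. *)
Implicit Types V : 'rV[R]_n.+1 -> R.

Definition diff_quot V (x p y : 'rV[R]_n.+1) : \bar R :=
  ((V y - V x - dotp p (y - x)) / enorm (y - x))%:E.

Definition Dplus V (x : 'rV[R]_n.+1) : set 'rV[R]_n.+1 :=
  [set p | (limf_esup (diff_quot V x p) (within Gbar x^') <= 0)%E].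

Definition Dminus V (x : 'rV[R]_n.+1) : set 'rV[R]_n.+1 :=
  [set p | (0 <= limf_einf (diff_quot V x p) (within Gbar x^'))%E].

(* The neutral elements -oo of max and +oo of min make the two bigops disappear
   when no coordinate of x vanishes. *)
Definition viscosity_solution V : Prop :=
  [/\ {within Gbar, continuous V},
      forall x p, domG z x -> Dplus V x p ->
        (0 <= maxe (Ham lam c mu p)
                   (\big[maxe/-oo]_(i in Iset x) (dotp p (gamma i))%:E))%E,
      forall x p, (domG z `\` boundary_c z) x -> Dminus V x p ->
        (mine (Ham lam c mu p)
              (\big[mine/+oo]_(i in Iset x) (dotp p (gamma i))%:E) <= 0)%E &
      forall x, boundary_o z x -> V x = 0].

(* The choice of the norm is immaterial for Lipschitz continuity. *)
Definition lipschitz_viscosity_solution V : Prop :=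
  [lipschitz V x | x in Gbar] /\ viscosity_solution V.

End Viscosity.

Section ExplicitSolution.
Context {R : realType} {n : nat}.

Definition positive_solution (lam c mui b : R) : Prop :=
  0 < b /\ c + lam * (1 - expR b) + mui * (1 - expR (- b)) = 0.

Variable beta : 'I_n.+1 -> R.

Definition bvec (i : 'I_n.+1) : 'rV[R]_n.+1 :=
  beta i *: \sum_(j < n.+1 | (j <= i)%N) unitv j.

(* Taking the value at the first index as the default element, the bigop is the
   minimum over all indices. *)
Definition minV (z x : 'rV[R]_n.+1) : R :=
  \big[Num.min/dotp (bvec ord0) (z - x)]_i dotp (bvec i) (z - x).

End ExplicitSolution.

(* Main.v *)
Require Import Defs.
From HB Require Import structures.
From mathcomp Require Import all_boot all_order all_algebra.
From mathcomp Require Import all_classical all_reals all_analysis.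
From mathcomp Require Import ring lra zify.
Import Order.TTheory GRing.Theory Num.Theory.
Import numFieldNormedType.Exports.
Local Open Scope classical_set_scope.
Local Open Scope ring_scope.
Set Implicit Arguments.
Unset Strict Implicit.
Unset Printing Implicit Defensive.

(** Write S_i(x) = sum_(j <= i) (z_j - x_j), so that V = min_i beta_i S_i, and,
    for a gradient p, w_i = - gamma_i . p, so that
      H(p) = c + lam (1 - e^(sum_i w_i)) + sum_i max(0, mu_i (1 - e^(- w_i))).
    On w >= 0 this is concave in w, equals c at 0 and vanishes at each point
    beta_i e_i; hence H(p) >= (1 - s) c as soon as sum_i w_i / beta_i <= s <= 1.

    A plane beta_i S_i, slightly steepened and tilted, has H < 0 and
    gamma_j . p < 0 for all j, so the D^+ conditions force any solution W below
    it, whence W <= V.  Conversely V is a uniform limit of smooth functions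
    phi = th softmin(beta_i S_i) - sum_j g_j(x_j) with th < 1, where the
    barriers g_j live in thin layers along the faces x_j = 0 and x_j = z_j.
    They make gamma_j . D phi > 0 on x_j = 0 and make phi decrease so steeply
    towards x_j = z_j (j > 1) that a minimum of W - phi never lies on
    boundary_c, where nothing is known about D^- W.  They also move mass of w
    between neighbouring indices.  Mass taken in excess of what an index holds
    only makes w_i negative there, which does not lower H; the rest moves from
    active indices to indices with no larger S_i (up to the thickness of the
    layers), hence no smaller beta_i.  So H(D phi) > 0 still holds, and W - phi
    can only be minimal near boundary_o.  This gives W >= V.  The same functions
    phi, used as perturbations of V, give the D^+ conditions for V itself. *)

(** * Scalar convexity estimates *)

Section Exponential.
Context {R : realType}.
Implicit Types a b c m s x : R.

Lemma expR_ge_tangent m b : expR m * (1 + b - m) <= expR b.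
Proof.
have -> : expR b = expR m * expR (b - m) by rewrite -expRD subrKC.
by rewrite ler_pM2l ?expR_gt0// -addrA expR_ge1Dx.
Qed.

(** Jensen's inequality with the missing weight [1 - \sum_i r i] placed at 0. It is the weighted
    average of the tangent bounds taken at the mean [m]. *)
Lemma expR_jensen (I : finType) (r b : I -> R) :
  (forall i, 0 <= r i) -> \sum_i r i <= 1 ->
  expR (\sum_i r i * b i) <= \sum_i r i * expR (b i) + (1 - \sum_i r i).
Proof.
move=> r0 r1; set m := \sum_i r i * b i; set t := \sum_i r i in r1 *.
have : \sum_i r i * (expR m * (1 + b i - m)) <= \sum_i r i * expR (b i).
  by apply: ler_sum => i _; rewrite ler_wpM2l// expR_ge_tangent.
have -> : \sum_i r i * (expR m * (1 + b i - m)) = expR m * (t * (1 - m) + m).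
  rewrite /t /m mulrDr mulrA !mulr_sumr mulr_suml -big_split/=.
  by apply: eq_bigr => i _; ring.
have : (1 - t) * (expR m * (1 + 0 - m)) <= (1 - t) * expR 0.
  by rewrite ler_wpM2l ?subr_ge0// expR_ge_tangent.
rewrite expR0; lra.
Qed.

Lemma one_sub_expRN_concave s b : 0 <= s <= 1 ->
  s * (1 - expR (- b)) <= 1 - expR (- (s * b)).
Proof.
move=> /andP[s0 s1].
have := @expR_jensen 'I_1 (fun=> s) (fun=> - b) (fun=> s0).
by rewrite !big_ord1 mulrN => /(_ s1); lra.
Qed.

Lemma one_sub_expRN_le x : 1 - expR (- x) <= x.
Proof. by have := expR_ge1Dx (- x); lra. Qed.

Lemma ler_expR_mul a x : 0 < a -> x * expR (- (a * x)) <= a^-1.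
Proof.
move=> a0; have e0 := expR_gt0 (a * x).
rewrite expRN ler_pdivrMr// -(ler_pM2l a0) mulrA divff ?gt_eqF// mul1r.
by have := expR_ge1Dx (a * x); lra.
Qed.

(** For [b >= 0] and [mu] the i-th rate, this is the Hamiltonian at the gradient of the plane
    [- b S_i]'s opposite sign convention, that is, with [w_i = b] and all other [w_j = 0]. *)
Definition balance (lam c mu b : R) :=
  c + lam * (1 - expR b) + mu * (1 - expR (- b)).

Lemma balance_concave lam c mu s b : 0 < lam -> 0 < mu -> 0 <= s <= 1 ->
  (1 - s) * c + s * balance lam c mu b <= balance lam c mu (s * b).
Proof.
move=> lam0 mu0 s01; have /andP[s0 s1] := s01; rewrite /balance.
have := @one_sub_expRN_concave s (- b) s01.
have := @one_sub_expRN_concave s b s01.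
rewrite mulrN !opprK -(ler_pM2l mu0) => h1; rewrite -(ler_pM2l lam0) => h2.
lra.
Qed.

(** By concavity, a nonnegative value at [b'] and the value [c > 0] at 0 would make the balance
    positive at the intermediate zero [b]. *)
Lemma balance_lt0 lam c mu b b' : 0 < lam -> 0 < mu -> 0 < c ->
  positive_solution lam c mu b -> b < b' -> balance lam c mu b' < 0.
Proof.
move=> lam0 mu0 c0 [b0 fb] bb'; rewrite ltNge; apply/negP => fb'.
have b'0 : 0 < b' by lra.
have s1 : b / b' < 1 by rewrite ltr_pdivrMr// mul1r.
have s0 : 0 < b / b' by exact: divr_gt0.
have /(balance_concave c b' lam0 mu0) : 0 <= b / b' <= 1 by rewrite !ltW.
rewrite divfK ?gt_eqF// [balance lam c mu b]fb leNgt => /negP; apply.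
by rewrite ltr_pwDl ?mulr_gt0 ?subr_gt0// mulr_ge0// ltW.
Qed.

Lemma positive_solution_exists_unique lam c mu : 0 < lam -> 0 < mu -> 0 < c ->
  exists! b, positive_solution lam c mu b.
Proof.
move=> lam0 mu0 c0; set f := balance lam c mu.
(* At the right end [x = (c + mu) / lam], [1 + x <= expR x] gives
   [lam * (1 - expR x) <= - (c + mu)], which outweighs the other terms. *)
have [b b0 fb] : exists2 b, b \in `[0, (c + mu) / lam] & f b = 0.
  have M0 : 0 <= (c + mu) / lam by rewrite divr_ge0 ?addr_ge0 ?ltW.
  apply: IVT => //.
    apply: continuous_subspaceT => x; rewrite /f.
    apply: cvgD; [apply: cvgD; first exact: cvg_cst|].
      apply: cvgM; [exact: cvg_cst|apply: cvgB; [exact: cvg_cst|]].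
      exact: continuous_expR.
    apply: cvgM; [exact: cvg_cst|apply: cvgB; [exact: cvg_cst|]].
    apply: (@continuous_comp _ _ _ -%R expR); last exact: continuous_expR.
    exact: opp_continuous.
  have f0 : 0 <= f 0 by rewrite /f/balance oppr0 expR0; lra.
  have fM : f ((c + mu) / lam) <= 0.
    have := expR_ge1Dx ((c + mu) / lam); rewrite -(ler_pM2l lam0).
    rewrite mulrDr mulrCA divff ?gt_eqF// => h.
    have := mulr_ge0 (ltW mu0) (expR_ge0 (- ((c + mu) / lam))).
    by rewrite /f/balance; lra.
  by rewrite ge_min le_max fM f0 orbT.
have bn0 : b != 0.
  apply/eqP => bE; move: fb; rewrite /f/balance bE oppr0 expR0 => ?; lra.
have sb : positive_solution lam c mu b.
  by split => //; rewrite lt_neqAle eq_sym bn0/=; case/andP: b0.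
exists b; split=> // b' sb'.
have [bb'|bb'|//] := ltgtP b b'.
  by have := balance_lt0 lam0 mu0 c0 sb bb'; rewrite /balance (sb'.2) ltxx.
by have := balance_lt0 lam0 mu0 c0 sb' bb'; rewrite /balance (sb.2) ltxx.
Qed.

(** [w] is the combination of the points beta_i e_i with weights [r i], the remaining weight sitting
    at the origin. Jensen handles the exponential of the sum, one-atom concavity handles each other
    term, and the equations of the [beta i] cancel everything but the share of the origin. *)
Lemma concave_lower_bound (I : finType) (lam c s : R) (mu beta w : I -> R) :
  0 < lam -> 0 < c -> (forall i, 0 < mu i) -> s <= 1 ->
  (forall i, positive_solution lam c (mu i) (beta i)) ->
  (forall i, 0 <= w i) -> \sum_i w i / beta i <= s ->
  (1 - s) * c <=
  c + lam * (1 - expR (\sum_i w i)) + \sum_i mu i * (1 - expR (- w i)).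
Proof.
move=> lam0 c0 mu0 s1 bs w0 ws; set r := fun i => w i / beta i.
have b0 i : 0 < beta i by exact: (bs i).1.
have wE i : w i = r i * beta i by rewrite /r divfK// gt_eqF.
have r0 i : 0 <= r i by rewrite divr_ge0// ltW.
have rs : \sum_i r i <= 1 by exact: le_trans s1.
have r1 i : r i <= 1.
  by apply: le_trans rs; rewrite (bigD1 i)//= lerDl sumr_ge0.
have := expR_jensen beta r0 rs; rewrite (eq_bigr _ (fun i _ => esym (wE i))).
rewrite -(ler_pM2l lam0) => h1.
have h2 : \sum_i r i * (mu i * (1 - expR (- beta i))) <=
          \sum_i mu i * (1 - expR (- w i)).
  apply: ler_sum => i _; rewrite mulrCA ler_pM2l// wE.
  by apply: one_sub_expRN_concave; rewrite r0 r1.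
have h3 : \sum_i r i * (mu i * (1 - expR (- beta i))) =
    lam * (\sum_i r i * expR (beta i) - \sum_i r i) - c * \sum_i r i.
  rewrite mulrBr !mulr_sumr -!sumrB; apply: eq_bigr => i _.
  have [_ e] := bs i.
  have -> : mu i * (1 - expR (- beta i)) = - (c + lam * (1 - expR (beta i))).
    by lra.
  by ring.
have h4 : c * \sum_i r i <= c * s by rewrite ler_pM2l.
lra.
Qed.

End Exponential.

(** * The Hamiltonian in closed form *)

Section RealHamiltonian.
Context {R : realType} {n : nat}.
Variables (lam c : R) (mu : 'I_n.+1 -> R).
Implicit Types (p : 'rV[R]_n.+1) (u : 'I_n.+1 -> R).

Definition hamR p : R :=
  c + lam * (1 - expR (- p 0 ord0)) +
  \sum_i Num.max 0 (mu i * (1 - expR (dotp (gamma i) p))).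

Definition ellR (x : R) : R := x * ln x - x + 1.

Lemma ellE (a m : R) : 0 < a -> 0 <= m ->
  (a%:E * ell (m / a))%E = (a * ellR (m / a))%:E.
Proof. by move=> a0 m0; rewrite /ell divr_ge0// ltW. Qed.

(** Young's inequality between [ell] and its convex dual; equality holds at [m = a * expR (- q)]. *)
Lemma ell_dual_ge (a m q : R) : 0 < a -> 0 <= m ->
  a * (1 - expR (- q)) <= m * q + a * ellR (m / a).
Proof.
move=> a0 m0; rewrite /ellR.
have {1}-> : m = a * (m / a) by rewrite mulrC divfK// gt_eqF.
rewrite -mulrA -mulrDr ler_pM2l//.
have : 0 <= m / a by rewrite divr_ge0// ltW.
move: (m / a) => x; rewrite le_eqVlt => /predU1P[<-|x0].
  by rewrite !mul0r; have := expR_ge0 (- q); lra.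
have : x * (1 + (- q - ln x)) <= x * expR (- q - ln x).
  by rewrite ler_pM2l// expR_ge1Dx.
rewrite expRB lnK ?posrE// mulrCA divff ?gt_eqF// mulr1; lra.
Qed.

Lemma ell_dual_eq (a q : R) : 0 < a ->
  let m := a * expR (- q) in
  a * (1 - expR (- q)) = m * q + a * ellR (m / a).
Proof.
move=> a0 m; rewrite /ellR /m [a * _ / a]mulrAC divff ?gt_eqF// mul1r expRK; ring.
Qed.

Hypotheses (lam0 : 0 < lam) (mu0 : forall i, 0 < mu i).

Let cost p u (m : R * ('I_n.+1 -> R)) : R :=
  c + (m.1 * p 0 ord0 + lam * ellR (m.1 / lam)) +
  \sum_i u i * (m.2 i * - dotp (gamma i) p + mu i * ellR (m.2 i / mu i)).

Let value p u : R :=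
  c + lam * (1 - expR (- p 0 ord0)) +
  \sum_i u i * (mu i * (1 - expR (dotp (gamma i) p))).

Let Ham3E p u m : Mset m -> Ham3 lam c mu p u m = (cost p u m)%:E.
Proof.
move=> [m10 m20]; rewrite /Ham3 /cost ellE//.
under eq_bigr do rewrite ellE// -EFinD -EFinM mulNr -mulrN.
by rewrite sumEFin -!EFinD.
Qed.

Let inf_cost p u : Uset u ->
  ereal_inf [set Ham3 lam c mu p u m | m in Mset] = (value p u)%:E.
Proof.
move=> Uu; apply/eqP; rewrite eq_le; apply/andP; split.
  apply: ereal_inf_lbound => /=.
  (* The equality case of Young's inequality in each component; as the weights [u i] are
     nonnegative, the infimum may be taken term by term. *)
  exists (lam * expR (- p 0 ord0), fun i => mu i * expR (dotp (gamma i) p)).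
    by split => [|i] /=; rewrite mulr_ge0 ?expR_ge0// ltW.
  rewrite Ham3E; last by split => [|i] /=; rewrite mulr_ge0 ?expR_ge0// ltW.
  congr EFin; rewrite /cost /value/= -ell_dual_eq//; congr +%R.
  apply: eq_bigr => i _; congr *%R.
  by rewrite -{1 3}[dotp (gamma i) p]opprK -ell_dual_eq// opprK.
apply: le_ereal_inf_tmp => _ [m Mm <-]; rewrite Ham3E// lee_fin /cost /value.
have [m10 m20] := Mm.
apply: lerD; first by rewrite lerD2l ell_dual_ge.
apply: ler_sum => i _.
rewrite ler_wpM2l//; first by case/andP: (Uu i).
by rewrite -{1}[dotp (gamma i) p]opprK ell_dual_ge.
Qed.

Lemma Ham_hamR p : Ham lam c mu p = (hamR p)%:E.
Proof.
apply/eqP; rewrite eq_le; apply/andP; split.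
  apply: ge_ereal_sup => _ [u Uu <-]; rewrite inf_cost// lee_fin /value /hamR.
  rewrite lerD2l ler_sum// => i _; set h := mu i * _.
  case/andP: (Uu i) => u0 u1; have [h0|h0] := leP 0 h.
    by rewrite ler_piMl.
  by rewrite mulr_ge0_le0// ltW.
apply: ereal_sup_ubound.
(* The optimal control is bang-bang: each service is switched on exactly when its term is
   nonnegative. *)
pose u i : R := if 0 <= mu i * (1 - expR (dotp (gamma i) p)) then 1 else 0.
have Uu : Uset u by move=> i; rewrite /u; case: ifP; rewrite ?lexx ?ler01.
exists u => //; rewrite inf_cost//; congr EFin; rewrite /value /hamR.
congr +%R; apply: eq_bigr => i _; rewrite /u.
by case: (leP 0); rewrite ?mul1r ?mul0r.
Qed.

End RealHamiltonian.

(** * Transport of mass between neighbouring indices *)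

Section Flow.
Context {R : realType}.
Implicit Types (u t a pi : nat -> R).

Lemma capped_flow u t : (forall k, 0 <= u k) -> (forall k, 0 <= t k) ->
  exists o : nat -> R, [/\ o 0%N = 0, forall k, 0 <= o k <= t k &
    forall k, 0 <= u k + o k - o k.+1 /\
      (o k.+1 = t k.+1 \/ u k + o k - o k.+1 = 0)].
Proof.
move=> u0 t0; pose fix o k : R :=
  if k is k'.+1 then Num.min (t k) (u k' + o k') else 0.
have o0 k : 0 <= o k by elim: k => //= k IH; rewrite le_min t0 addr_ge0.
exists o; split=> // [[|k]|k]; rewrite ?lexx ?t0 ?o0//.
  by rewrite /= ge_min lexx.
rewrite /=; case: (leP (t k.+1) (u k + o k)) => h; split; try by [left|right; lra].
- by lra.
- by lra.
Qed.

(** Abel summation: the hypothesis says that every interior term has the favourable sign. *)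
Lemma sum_by_parts_le pi a M :
  (forall k, (0 < k <= M)%N -> 0 <= (pi k - pi k.-1) * a k) ->
  \sum_(k < M.+1) pi k * (a k.+1 - a k) <= pi M * a M.+1 - pi 0%N * a 0%N.
Proof.
elim: M => [|M IH] h; first by rewrite big_ord1; lra.
rewrite big_ord_recr/=.
have {}IH := IH (fun k hk => h k ltac:(lia)).
have := h M.+1 ltac:(lia); rewrite /=; lra.
Qed.

(** [tr k] and [tl k] are the masses demanded across the edge between [k - 1] and [k], rightwards
    and leftwards; [tl 0] leaves the system. Demands may exceed the mass present, so the flows are
    capped. The result lies below the positive part of the full transport, and its cost does not
    grow because mass only moves to sites of no larger [pi]. *)
Lemma capped_redistribution (M : nat) u pi tl tr :
  (forall k, 0 <= u k) -> (forall k, 0 <= tl k) -> (forall k, 0 <= tr k) ->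
  (forall k, 0 < tl k -> tr k = 0) ->
  tr 0%N = 0 -> tr M.+1 = 0 -> tl M.+1 = 0 -> 0 <= pi 0%N ->
  (forall k, (0 < k <= M)%N -> 0 < tr k -> pi k <= pi k.-1) ->
  (forall k, (0 < k <= M)%N -> 0 < tl k -> pi k.-1 <= pi k) ->
  exists w : nat -> R, [/\
    forall k, (k <= M)%N ->
      0 <= w k <= Num.max 0 (u k + tr k - tr k.+1 + tl k.+1 - tl k),
    \sum_(k < M.+1) u k - tl 0%N <= \sum_(k < M.+1) w k &
    \sum_(k < M.+1) pi k * w k <= \sum_(k < M.+1) pi k * u k].
Proof.
move=> u0 tl0 tr0 tlr tr00 trM tlM pi0 pir pil.
(* The leftward flow is a rightward one with reversed indices; the rightward flow [r] is then run on
   the masses [u1] that it leaves. *)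
have [l' [l'0 l't l'c]] :=
  @capped_flow (fun k => u (M - k)%N) (fun k => tl (M.+1 - k)%N)
    (fun=> u0 _) (fun=> tl0 _).
pose l k := l' (M.+1 - k)%N.
have lM : l M.+1 = 0 by rewrite /l subnn.
have lt k : (k <= M.+1)%N -> 0 <= l k <= tl k.
  by move=> kM; have := l't (M.+1 - k)%N; rewrite subKn.
have lc k : (k <= M)%N -> 0 <= u k + l k.+1 - l k /\
    (l k = tl k \/ u k + l k.+1 - l k = 0).
  move=> kM; have := l'c (M - k)%N.
  by rewrite /l subKn// subSS -subSn// subKn ?leqW.
pose u1 k := if (k <= M)%N then u k + l k.+1 - l k else 0.
have u10 k : 0 <= u1 k by rewrite /u1; case: ifP => // /lc[].
have [r [r0 rt rc]] := capped_flow u10 tr0.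
(* The net leftward flux across edge [k]. *)
pose a k := l k - r k.
exists (fun k => u k + (a k.+1 - a k)).
have rM : r M.+1 = 0.
  by have := rt M.+1; rewrite trM => h; apply/eqP; rewrite eq_le andbC.
split=> [k kM||].
- have := rc k; rewrite /u1 kM => -[w0 rk]; rewrite le_max; apply/andP; split.
    by move: w0; rewrite /a; lra.
  case: rk => [rk|e]; last by apply/orP; left; rewrite /a; lra.
  have [_ [lk|lk]] := lc k kM.
    apply/orP; right; rewrite /a.
    have := rt k; have := lt k.+1 ltac:(lia); lra.
  (* If the leftward flow empties site [k] without saturating its edge, that edge carries nothing
     rightwards, so nothing comes back and [w k <= 0]. *)
  have [ltk|] := ltP (l k) (tl k); last first.
    move=> tll; apply/orP; right; rewrite /a.
    have := rt k; have := lt k.+1 ltac:(lia); lra.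
  have tl_gt0 : 0 < tl k by have := lt k ltac:(lia); lra.
  have rk0 : r k = 0 by have := rt k; rewrite tlr//; lra.
  by apply/orP; left; have := rt k.+1; rewrite /a rk0; lra.
- rewrite big_split/= lerD2l -(big_mkord xpredT (fun k => a k.+1 - a k)).
  rewrite telescope_sumr// /a lM rM r0.
  by have := lt 0%N ltac:(lia); lra.
- have -> : \sum_(k < M.+1) pi k * (u k + (a k.+1 - a k)) =
    \sum_(k < M.+1) pi k * u k + \sum_(k < M.+1) pi k * (a k.+1 - a k).
    by rewrite -big_split/=; apply: eq_bigr => k _; rewrite mulrDr.
  rewrite gerDl; apply: le_trans (sum_by_parts_le _) _; last first.
    rewrite /a lM rM r0; have := lt 0%N ltac:(lia); nra.
  move=> k kM; rewrite /a.
  have := rt k; have := lt k ltac:(lia) => lk rk.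
  have [trk|trk] := ltP 0 (tr k).
    have -> : l k = 0.
      have [tlk|tlk] := ltP 0 (tl k); last lra.
      by move: trk; rewrite tlr// ltxx.
    have := pir k kM trk; nra.
  have [tlk|tlk] := ltP 0 (tl k); last by rewrite (_ : l k - r k = 0) ?mulr0//; lra.
  have := pil k kM tlk; nra.
Qed.

End Flow.

(** * Lower bound for the Hamiltonian through capped masses *)

Section HamLower.
Context {R : realType} {n : nat}.
Variables (lam c : R) (mu beta : 'I_n.+1 -> R).

(** The arrival term decreases in [- p 0 ord0], while each service term is nondecreasing in
    [- dotp (gamma i) p] and constant where that is negative. Hence [w] may replace the true values
    before concavity is used. *)
Lemma hamR_lower_bound (p : 'rV[R]_n.+1) (w : 'I_n.+1 -> R) s :
  0 < lam -> 0 < c -> (forall i, 0 < mu i) -> s <= 1 ->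
  (forall i, positive_solution lam c (mu i) (beta i)) ->
  (forall i, 0 <= w i <= Num.max 0 (- dotp (gamma i) p)) ->
  - p 0 ord0 <= \sum_i w i -> \sum_i w i / beta i <= s ->
  (1 - s) * c <= hamR lam c mu p.
Proof.
move=> lam0 c0 mu0 s1 bs w0 pw ws.
have := concave_lower_bound lam0 c0 mu0 s1 bs (fun i => proj1 (andP (w0 i))) ws.
move=> /le_trans; apply; apply: lerD.
  by rewrite lerD2l ler_pM2l// lerD2l lerN2 ler_expR.
apply: ler_sum => i _; case/andP: (w0 i) => wi0.
rewrite le_max => /orP[wi|wi].
  have -> : w i = 0 by apply/eqP; rewrite eq_le wi.
  by rewrite oppr0 expR0 subrr mulr0 le_max lexx.
rewrite le_max; apply/orP; right; rewrite ler_pM2l// lerD2l lerN2 ler_expR.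
by rewrite lerNr.
Qed.
End HamLower.

(** * The closed box and the semidifferentials *)

Section RowVectors.
Context {R : realType} {n : nat}.
Implicit Types (p q x y v : 'rV[R]_n.+1) (i j : 'I_n.+1).

Lemma coord_le_norm v i : `|v 0 i| <= `|v|.
Proof.
by rewrite [leRHS]/Num.Def.normr/= mx_normrE; apply/bigmax_geP; right; exists (0, i).
Qed.

Lemma norm_le_coord v (e : R) : 0 <= e -> (forall i, `|v 0 i| <= e) -> `|v| <= e.
Proof.
move=> e0 ve; rewrite [leLHS]/Num.Def.normr/= mx_normrE.
apply/bigmax_leP; split => //.
by move=> -[i j] _ /=; rewrite (ord1 i).
Qed.

Lemma coord_add_unitv x (h : R) i j :
  (x + h *: unitv i) 0 j = x 0 j + h * (j == i)%:R.
Proof. by rewrite !mxE eqxx. Qed.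

Lemma norm_scale_unitv (h : R) i : `|h *: unitv i : 'rV[R]_n.+1| = `|h|.
Proof.
apply/eqP; rewrite eq_le norm_le_coord//=; last first.
  move=> j; rewrite !mxE eqxx/=.
  by case: eqP => _; rewrite ?mulr1 ?mulr0 ?normr0.
by have := coord_le_norm (h *: unitv i) i; rewrite !mxE !eqxx mulr1.
Qed.

Lemma dotpC p q : dotp p q = dotp q p.
Proof. by apply: eq_bigr => i _; rewrite mulrC. Qed.

Lemma dotpDr p x y : dotp p (x + y) = dotp p x + dotp p y.
Proof. by rewrite -big_split; apply: eq_bigr => i _; rewrite mxE mulrDr. Qed.

Lemma dotpZr p (a : R) x : dotp p (a *: x) = a * dotp p x.
Proof. by rewrite mulr_sumr; apply: eq_bigr => i _; rewrite mxE mulrCA. Qed.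

Lemma dotpNr p x : dotp p (- x) = - dotp p x.
Proof. by rewrite -scaleN1r dotpZr mulN1r. Qed.

Lemma dotpBr p x y : dotp p (x - y) = dotp p x - dotp p y.
Proof. by rewrite dotpDr dotpNr. Qed.

Lemma dotpDl p q x : dotp (p + q) x = dotp p x + dotp q x.
Proof. by rewrite dotpC dotpDr !(dotpC x). Qed.

Lemma dotpZl (a : R) p x : dotp (a *: p) x = a * dotp p x.
Proof. by rewrite dotpC dotpZr dotpC. Qed.

Lemma dotpNl p x : dotp (- p) x = - dotp p x.
Proof. by rewrite dotpC dotpNr dotpC. Qed.

Lemma dotpBl p q x : dotp (p - q) x = dotp p x - dotp q x.
Proof. by rewrite dotpDl dotpNl. Qed.

Lemma dotp_suml (I : finType) (P : pred I) (F : I -> 'rV[R]_n.+1) x :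
  dotp (\sum_(i | P i) F i) x = \sum_(i | P i) dotp (F i) x.
Proof.
elim/big_rec2: _ => [|i a b _ <-]; last by rewrite dotpDl.
by apply: big1 => i _; rewrite mxE mul0r.
Qed.

Lemma dotp_unitv p i : dotp p (unitv i) = p 0 i.
Proof.
rewrite /dotp (bigD1 i)//= big1 ?addr0 => [|j ji].
  by rewrite mxE !eqxx mulr1.
by rewrite mxE (negbTE ji) andbF mulr0.
Qed.

Lemma dotp_gamma p i :
  dotp p (gamma i) = p 0 i - (if (i < n)%N then p 0 (inord i.+1) else 0).
Proof.
by rewrite /gamma; case: ifP => _; rewrite ?dotpBr !dotp_unitv ?subr0.
Qed.

Lemma norm_dotp_le p v : `|dotp p v| <= (\sum_i `|p 0 i|) * `|v|.
Proof.
apply: le_trans (ler_norm_sum _ _ _) _; rewrite mulr_suml.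
by apply: ler_sum => i _; rewrite normrM ler_wpM2l// coord_le_norm.
Qed.

Lemma dotp_continuous p : continuous (dotp p).
Proof.
move=> x s /(nbhs_ballP (dotp p x))[e /= e0 es].
have k0 : 0 < \sum_i `|p 0 i| + 1 by rewrite ltr_wpDl// sumr_ge0.
apply/nbhs_ballP; exists (e / (\sum_i `|p 0 i| + 1)) => /=.
  exact: divr_gt0.
move=> y; rewrite -ball_normE/= ltr_pdivlMr// mulrC => xy.
apply: es; rewrite -ball_normE/= -dotpBr (le_lt_trans (norm_dotp_le _ _))//.
rewrite (le_lt_trans _ xy)//.
by rewrite ler_wpM2r// lerDl.
Qed.

Lemma norm_le_enorm v : `|v| <= enorm v.
Proof.
apply: norm_le_coord; first exact: sqrtr_ge0.
move=> i; rewrite -sqrtr_sqr ler_sqrt; last first.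
  by apply: sumr_ge0 => j _; rewrite -expr2 sqr_ge0.
rewrite /dotp (bigD1 i)//= -expr2 lerDl.
by apply: sumr_ge0 => j _; rewrite -expr2 sqr_ge0.
Qed.

Lemma enorm_le_norm v : enorm v <= n.+1%:R * `|v|.
Proof.
rewrite /enorm -[leRHS]ger0_norm ?mulr_ge0// -sqrtr_sqr ler_sqrt ?sqr_ge0//.
have -> : dotp v v = \sum_i `|v 0 i| ^+ 2.
  by apply: eq_bigr => i _; rewrite -normrX ger0_norm ?sqr_ge0// expr2.
apply: (@le_trans _ _ (\sum_(i < n.+1) `|v| ^+ 2)).
  by apply: ler_sum => i _; rewrite ler_sqr ?nnegrE// coord_le_norm.
rewrite sumr_const card_ord exprMn -[leLHS]mulr_natl ler_wpM2r ?sqr_ge0//.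
by rewrite expr2 ler_peMl// ler1n.
Qed.

End RowVectors.

Section Box.
Context {R : realType} {n : nat}.
Implicit Types x y z : 'rV[R]_n.+1.

Definition box z : set 'rV[R]_n.+1 := [set x | forall i, 0 <= x 0 i <= z 0 i].

Lemma box_compact z : compact (box z).
Proof.
apply: (@rV_compact R n.+1 (fun i => [set t | 0 <= t <= z 0 i])) => i.
have -> : [set t | 0 <= t <= z 0 i] = `[0, z 0 i]%classic.
  by apply/seteqP; split=> t /=; rewrite in_itv.
exact: segment_compact.
Qed.

Lemma closure_domG z : (forall i, 0 < z 0 i) -> closure (domG z) = box z.
Proof.
move=> z0; apply/seteqP; split.
  have /closure_id -> : closed (box z).
    by apply: compact_closed; [exact: norm_hausdorff|exact: box_compact].
  apply: closure_subset => x [/andP[x0 x1] xi] i.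
  by have [->|/xi//] := eqVneq i ord0; rewrite x0 ltW.
move=> x xb B /nbhs_ballP[e /= e0 eB].
pose h := Num.min (e / 2) (z 0 ord0 / 2).
have z00 := z0 ord0.
have h0 : 0 < h by rewrite lt_min !divr_gt0.
have [xz|xz] := ltP (x 0 ord0) (z 0 ord0).
  exists x; split; last exact/eB/ballxx.
  by split => [|i _]; [rewrite xz andbT; case/andP: (xb ord0)|exact: xb].
exists (x + (- h) *: unitv ord0); split.
  split => [|i i0]; rewrite coord_add_unitv.
    have hz : h <= z 0 ord0 / 2 by rewrite ge_min lexx orbT.
    have := xb ord0; rewrite eqxx mulr1; lra.
  by rewrite (negbTE i0) mulr0 addr0.
apply: eB; rewrite -ball_normE/= opprD addrA subrr sub0r normrN norm_scale_unitv.
have : h <= e / 2 by rewrite ge_min lexx.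
by rewrite normrN gtr0_norm//; lra.
Qed.

Lemma box_domG z x : box z x -> x 0 ord0 < z 0 ord0 -> domG z x.
Proof.
move=> xb xz; split=> [|i _]; last exact: xb.
by rewrite xz andbT; case/andP: (xb ord0).
Qed.

End Box.

(** * Semidifferentials in epsilon-delta form *)

Section SemiDifferentials.
Context {R : realType} {n : nat}.
Variable z : 'rV[R]_n.+1.
Hypothesis z0 : forall i, 0 < z 0 i.
Implicit Types (p x y : 'rV[R]_n.+1) (V : 'rV[R]_n.+1 -> R).

Lemma DplusP V x p : Dplus z V x p <->
  forall d : R, 0 < d -> exists2 r : R, 0 < r & forall y, box z y ->
    `|y - x| < r -> V y - V x - dotp p (y - x) <= d * `|y - x|.
Proof.
rewrite /Dplus /= closure_domG// limf_esupE; split=> [h d d0|h].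
  have n0 : (0 : R) < n.+1%:R by [].
  have /ereal_inf_lt[_ [A wA <-] /ltW Ad] :
      (* The factor [n.+1] pays for the passage from the Euclidean norm to the sup norm. *)
      (ereal_inf [set ereal_sup (diff_quot V x p @` A) | A in within (box z) x^'] <
       (d / n.+1%:R)%:E)%E.
    by apply: le_lt_trans h _; rewrite lte_fin divr_gt0.
  move: wA => /nbhs_ballP[r /= r0 rA]; exists r => // y yb yr.
  have [->|yx] := eqVneq y x.
    by rewrite !subrr normr0 mulr0 -(subrr x) dotpBr subrr subr0.
  have Ay : A y.
    by apply: rA => //; rewrite -ball_normE/= distrC.
  have : (diff_quot V x p y <= (d / n.+1%:R)%:E)%E.
    by apply: le_trans Ad; apply: ereal_sup_ubound; exists y.
  have yx0 : 0 < enorm (y - x).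
    by apply: lt_le_trans (norm_le_enorm _); rewrite normr_gt0 subr_eq0.
  rewrite lee_fin ler_pdivrMr// => /le_trans; apply.
  rewrite -mulrA ler_pM2l// mulrC ler_pdivrMr// mulrC.
  exact: enorm_le_norm.
apply/lee_addgt0Pr => d d0; rewrite add0e; have [r r0 rV] := h d d0.
apply: (@le_trans _ _ (ereal_sup (diff_quot V x p @`
    [set y | [/\ box z y, y != x & `|y - x| < r]]))).
  apply: ereal_inf_lbound; eexists; last by [].
  apply/nbhs_ballP; exists r => //= y; rewrite -ball_normE/= distrC => yr yx yb.
  by split=> //; exact: yx.
apply: ge_ereal_sup => _ [y [yb yx yr] <-]; rewrite lee_fin.
have yx0 : 0 < enorm (y - x).
  by apply: lt_le_trans (norm_le_enorm _); rewrite normr_gt0 subr_eq0.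
rewrite ler_pdivrMr// (le_trans (rV y yb yr))// ler_pM2l//.
exact: norm_le_enorm.
Qed.

Lemma Dminus_DplusN V x p : Dminus z V x p <-> Dplus z (- V) x (- p).
Proof.
rewrite /Dminus /Dplus /= /limf_einf oppe_ge0.
suff -> : (\- diff_quot V x p)%E = diff_quot (- V) x (- p) by [].
apply/funext => y; apply: (congr1 EFin (x := - _)); rewrite -mulNr; congr (_ / _).
by rewrite dotpNl !fctE; ring.
Qed.

Lemma DminusP V x p : Dminus z V x p <->
  forall d : R, 0 < d -> exists2 r : R, 0 < r & forall y, box z y ->
    `|y - x| < r -> - (d * `|y - x|) <= V y - V x - dotp p (y - x).
Proof.
rewrite Dminus_DplusN DplusP; split=> h d /h[r r0 rV]; exists r => // y yb yr;
  by have := rV y yb yr; rewrite dotpNl !fctE; lra.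
Qed.

End SemiDifferentials.

(** * The candidate as a minimum of planes *)

Section Planes.
Context {R : realType} {n : nat}.
Variables (beta : 'I_n.+1 -> R) (z : 'rV[R]_n.+1).
Implicit Types (x y : 'rV[R]_n.+1) (i j k : 'I_n.+1).

Definition slack (i : 'I_n.+1) x : R := \sum_(j < n.+1 | (j <= i)%N) (z 0 j - x 0 j).

Definition plane i x : R := dotp (bvec beta i) (z - x).

Lemma bvec_coord i j : bvec beta i 0 j = beta i * (j <= i)%N%:R.
Proof.
rewrite /bvec mxE summxE; congr (_ * _).
rewrite (eq_bigr (fun k => (j == k)%:R)) => [|k _]; last by rewrite mxE eqxx.
have [ji|ji] := boolP (j <= i)%N.
  rewrite (bigD1 j)//= eqxx big1 ?addr0// => k /andP[_ kj].
  by rewrite eq_sym (negbTE kj).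
by apply: big1 => k ki; case: eqP => // jk; rewrite jk ki in ji.
Qed.

Lemma planeE i x : plane i x = beta i * slack i x.
Proof.
rewrite /plane /dotp /slack [in RHS]big_mkcond/= mulr_sumr; apply: eq_bigr => j _.
by rewrite bvec_coord !mxE; case: ifP => _ /=; ring.
Qed.

Lemma planeB i x y : plane i y = plane i x - dotp (bvec beta i) (y - x).
Proof. by rewrite -dotpBr; congr dotp; rewrite opprB addrA subrK. Qed.

Lemma slack_ord0 x : slack ord0 x = z 0 ord0 - x 0 ord0.
Proof.
rewrite /slack (bigD1 ord0)//= big1 ?addr0// => i.
by rewrite leqn0 -val_eqE/= => /andP[->].
Qed.

Lemma slack_inord (k : nat) x : (0 < k <= n)%N ->
  slack (inord k) x = slack (inord k.-1) x + (z 0 (inord k) - x 0 (inord k)).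
Proof.
move=> kn; rewrite /slack (bigD1 (inord k))//= addrC; congr (_ + _).
apply: eq_bigl => j; rewrite -val_eqE/= !inordK; lia.
Qed.

Lemma slack_ge i x : box z x -> z 0 ord0 - x 0 ord0 <= slack i x.
Proof.
move=> xb; rewrite /slack (bigD1 ord0)//= lerDl.
by apply: sumr_ge0 => j _; have := xb j; lra.
Qed.

Lemma slack_ge0 i x : box z x -> 0 <= slack i x.
Proof. by move=> xb; apply: sumr_ge0 => j _; have := xb j; lra. Qed.

Lemma minV_le i x : minV beta z x <= plane i x.
Proof. by rewrite /minV; exact: bigmin_le_cond. Qed.

Lemma minV_attained x : exists i, minV beta z x = plane i x.
Proof.
rewrite /minV; elim/big_ind: _ => [|a b [i ->] [j ->]|i _]; last by exists i.
  by exists ord0.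
by case: (leP (plane i x) (plane j x)); [exists i|exists j].
Qed.

Lemma dotp_bvec_gamma i k : dotp (bvec beta k) (gamma i) = beta k * (i == k)%:R.
Proof.
rewrite dotp_gamma !bvec_coord -val_eqE/=; case: ifP => in0.
  rewrite inordK// -mulrBr; congr (_ * _).
  by case: ltngtP => ?; rewrite ?subrr ?subr0.
have := ltn_ord k; have := ltn_ord i.
by rewrite subr0 => ? ?; congr (_ * _%:R); lia.
Qed.

End Planes.

Section MinPlanes.
Context {R : realType} {n : nat}.
Variables (lam c : R) (mu beta : 'I_n.+1 -> R) (z : 'rV[R]_n.+1).
Implicit Types (p x y : 'rV[R]_n.+1).

Let lipV : R := \sum_i \sum_j `|bvec beta i 0 j|.

Lemma minV_lipschitz x y : `|minV beta z x - minV beta z y| <= lipV * `|x - y|.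
Proof.
suff h u v : minV beta z u - minV beta z v <= lipV * `|u - v|.
  rewrite ler_norml h andbT; have := h y x; rewrite distrC; lra.
have [i ->] := minV_attained beta z v.
apply: (@le_trans _ _ (plane beta z i u - plane beta z i v)).
  by rewrite lerD2r minV_le.
rewrite (planeB beta z i v u) addrAC subrr sub0r.
apply: le_trans (ler_norm _) _; rewrite normrN.
apply: le_trans (norm_dotp_le _ _) _; rewrite ler_wpM2r//.
rewrite /lipV [leRHS](bigD1 i)//= lerDl.
by apply: sumr_ge0 => j _; apply: sumr_ge0 => k _.
Qed.

Lemma minV_ge0 x : (forall i, 0 < beta i) -> box z x -> 0 <= minV beta z x.
Proof.
move=> b0 xb; have [i ->] := minV_attained beta z x.
by rewrite planeE mulr_ge0 ?slack_ge0// ltW.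
Qed.

Lemma minV_le_ord0 x : minV beta z x <= beta ord0 * (z 0 ord0 - x 0 ord0).
Proof. by rewrite -slack_ord0 -planeE minV_le. Qed.

Lemma hamR_bvec i (lam0 : 0 < lam) (mu0 : forall i, 0 < mu i) :
  (forall i, positive_solution lam c (mu i) (beta i)) ->
  hamR lam c mu (- bvec beta i) = 0.
Proof.
move=> bs; have [bi e] := bs i; rewrite /hamR mxE bvec_coord/= mulr1 opprK.
rewrite (bigD1 i)//= big1 => [|j ji].
  rewrite dotpC dotpNl dotp_bvec_gamma eqxx mulr1 addr0 max_r//.
  by rewrite mulr_ge0 ?ltW// subr_gt0 expR_lt1; lra.
rewrite dotpC dotpNl dotp_bvec_gamma (negbTE ji) mulr0 oppr0 expR0 subrr mulr0.
by rewrite maxxx.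
Qed.

(* If [x] has vanishing coordinates, the last one already violates
   [p . gamma > 0]; otherwise [p] is the gradient of an active plane. *)
Lemma minV_Dminus x p : (forall i, 0 < z 0 i) -> 0 < lam -> (forall i, 0 < mu i) ->
  (forall i, positive_solution lam c (mu i) (beta i)) ->
  (domG z `\` boundary_c z) x -> Dminus z (minV beta z) x p ->
  hamR lam c mu p <= 0 \/ exists2 i, x 0 i == 0 & dotp p (gamma i) <= 0.
Proof.
move=> z0 lam0 mu0 bs [[xz0 xz] xc] /(DminusP z0) hp.
have xlt i : 0 <= x 0 i < z 0 i.
  have [->//|i0] := eqVneq i ord0.
  have /andP[-> xi] := xz i i0; rewrite lt_neqAle xi andbT.
  by apply/negP => /eqP e; apply: xc; split=> //; exists i.
have [i Vi] := minV_attained beta z x.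
(* V lies below the active plane and touches it at [x], so along any coordinate direction staying in
   the box the slope of [p] cannot exceed that of the plane. *)
have key (j : 'I_n.+1) (s : R) : `|s| = 1 -> (x 0 j == 0 -> s = 1) ->
    (p 0 j + bvec beta i 0 j) * s <= 0.
  move=> s1 sj; apply/ler_addgt0Pr => d d0; rewrite add0r.
  have [r r0 hr] := hp d d0.
  (* When [x 0 j = 0] only the inward direction [s = 1] occurs, and the last entry 1 is a mere
     placeholder. *)
  pose h : R := Num.min (r / 2) (Num.min (z 0 j - x 0 j)
    (if x 0 j == 0 then 1 else x 0 j)).
  have [xj0 xjz] := andP (xlt j).
  have h0 : 0 < h.
    rewrite !lt_min divr_gt0//= subr_gt0 xjz/=.
    by case: eqVneq => // xj; rewrite lt_neqAle eq_sym xj.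
  pose y := x + (h * s) *: unitv j.
  have yx : y - x = (h * s) *: unitv j by rewrite addrAC subrr add0r.
  have nyx : `|y - x| = h by rewrite yx norm_scale_unitv normrM s1 mulr1 gtr0_norm.
  have hz : h <= z 0 j - x 0 j by rewrite !ge_min lexx orbT.
  have hx : x 0 j != 0 -> h <= x 0 j.
    by move=> /negbTE xj; rewrite /h xj !ge_min lexx !orbT.
  have yb : box z y.
    move=> k; rewrite coord_add_unitv; have [->|kj] := eqVneq k j; last first.
      by rewrite mulr0 addr0; have := xlt k; lra.
    rewrite mulr1; have [xj|/hx hxj] := eqVneq (x 0 j) 0.
      by rewrite sj ?xj// mulr1; lra.
    have : `|h * s| <= h by rewrite normrM s1 mulr1 gtr0_norm.
    by rewrite ler_norml; lra.
  have yr : `|y - x| < r.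
    have hr2 : h <= r / 2 by rewrite ge_min lexx.
    by rewrite nyx; lra.
  have := hr y yb yr; rewrite nyx.
  have := minV_le beta z i y.
  rewrite (planeB beta z i x y) -Vi yx !dotpZr !dotp_unitv.
  move=> h1 h2; have : h * ((p 0 j + bvec beta i 0 j) * s) <= h * d by lra.
  by rewrite ler_pM2l.
have pE j : x 0 j != 0 -> p 0 j = - bvec beta i 0 j.
  move=> xj; have := key j 1 (normr1 _) (fun=> erefl).
  have := key j (-1); rewrite normrN1 (negbTE xj) => /(_ erefl) h.
  by have := h ltac:(by []); lra.
have pL j : p 0 j <= - bvec beta i 0 j.
  by have := key j 1 (normr1 _) (fun=> erefl); lra.
have [[j xj]|noI] := pselect (exists j, x 0 j == 0); last first.
  left; rewrite (_ : p = - bvec beta i) ?hamR_bvec//.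
  apply/rowP => j; rewrite [RHS]mxE; apply: pE; apply/negP => xj.
  by apply: noI; exists j.
(* By maximality coordinate [k + 1], if there is one, is nonzero, so there [p] equals the gradient
   of the plane, while [pL] bounds it at [k]. *)
right; have [k xk kmax] := arg_maxnP (P := fun j => x 0 j == 0) val xj.
exists k => //; rewrite dotp_gamma.
have : - bvec beta i 0 k - (if (k < n)%N then - bvec beta i 0 (inord k.+1) else 0)
    <= 0.
  have : 0 <= dotp (bvec beta i) (gamma k).
    by rewrite dotp_bvec_gamma mulr_ge0// ltW// (bs i).1.
  by rewrite dotp_gamma; case: ifP; lra.
have := pL k; case: ifP => kn; last by lra.
rewrite (pE (inord k.+1)); first by lra.
by apply/negP => /kmax /=; rewrite inordK// ltnn.
Qed.

End MinPlanes.

(** * Smooth strict subsolutions *)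

Section SoftMin.
Context {R : realType} {n : nat}.
Variables (beta : 'I_n.+1 -> R) (z : 'rV[R]_n.+1) (eps : R).
Implicit Types (x y v : 'rV[R]_n.+1) (i k : 'I_n.+1).

Lemma expR_le_quad (u : R) : `|u| <= 2^-1 -> expR u <= 1 + u + 2 * u ^+ 2.
Proof.
rewrite ler_norml => /andP[u1 u2].
have h1 := expR_ge1Dx (- u); have h2 := expR_gt0 u.
have h3 : expR u * (1 - u) <= 1 by rewrite -[leRHS](expRxMexpNx_1 u) ler_pM2l.
rewrite -(@ler_pM2r _ (1 - u)); last by lra.
apply: le_trans h3 _; rewrite -subr_ge0.
have -> : (1 + u + 2 * u ^+ 2) * (1 - u) - 1 = u ^+ 2 * (1 - 2 * u) by ring.
apply: mulr_ge0; [exact: sqr_ge0|lra].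
Qed.

(** Log-sum-exp smoothing of the minimum at temperature [eps]: [softZ] is the partition function and
    the [softw i] are the Gibbs weights that average the gradients of the planes. *)
Definition softZ x : R := \sum_i expR (- (plane beta z i x / eps)).

Definition softmin x : R := - (eps * ln (softZ x)).

Definition softw i x : R := expR (- (plane beta z i x / eps)) / softZ x.

Lemma softZ_gt0 x : 0 < softZ x.
Proof.
rewrite /softZ (bigD1 ord0)//= ltr_pwDl ?expR_gt0//.
by apply: sumr_ge0 => i _; exact: expR_ge0.
Qed.

Lemma softw_gt0 i x : 0 < softw i x.
Proof. by rewrite divr_gt0 ?expR_gt0 ?softZ_gt0. Qed.

Lemma softw_sum x : \sum_i softw i x = 1.
Proof. by rewrite -mulr_suml divff// gt_eqF// softZ_gt0. Qed.

Lemma softw_le1 i x : softw i x <= 1.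
Proof.
rewrite -(softw_sum x) (bigD1 i)//= lerDl.
by apply: sumr_ge0 => j _; rewrite ltW// softw_gt0.
Qed.

Lemma softw_le i k x :
  softw i x <= expR (- ((plane beta z i x - plane beta z k x) / eps)).
Proof.
rewrite /softw ler_pdivrMr ?softZ_gt0//.
have -> : - (plane beta z i x / eps) =
    - ((plane beta z i x - plane beta z k x) / eps) - plane beta z k x / eps.
  by rewrite mulrBl; ring.
rewrite [leLHS]expRD ler_wpM2l ?expR_ge0// /softZ (bigD1 k)//= lerDl.
by apply: sumr_ge0 => j _; rewrite expR_ge0.
Qed.

Lemma softmin_le x : 0 < eps -> softmin x <= minV beta z x.
Proof.
move=> e0; have [i ->] := minV_attained beta z x.
rewrite /softmin lerNl mulrC -ler_pdivrMr// mulNr.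
rewrite -[leLHS]expRK ler_ln ?posrE ?expR_gt0 ?softZ_gt0//.
rewrite /softZ (bigD1 i)//= lerDl.
by apply: sumr_ge0 => j _; rewrite expR_ge0.
Qed.

Lemma softmin_ge x : 0 < eps -> minV beta z x - eps * n.+1%:R <= softmin x.
Proof.
move=> e0; set V := minV beta z x.
suff : ln (softZ x) <= n.+1%:R - V / eps.
  rewrite -(ler_pM2l e0) mulrBr mulrCA divff ?gt_eqF// mulr1 /softmin; lra.
have hZ : softZ x <= n.+1%:R * expR (- (V / eps)).
  rewrite mulr_natl -[X in _ *+ X]card_ord -sumr_const.
  apply: ler_sum => i _; rewrite ler_expR lerN2 ler_pM2r ?invr_gt0//.
  exact: minV_le.
have : ln (softZ x) <= ln (n.+1%:R * expR (- (V / eps))).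
  by rewrite ler_ln ?posrE ?softZ_gt0// mulr_gt0 ?expR_gt0.
rewrite lnM ?posrE ?expR_gt0// expRK => /le_trans; apply.
by rewrite lerD2r ltW// ln_sublinear.
Qed.

Definition soft_grad x : 'rV[R]_n.+1 := - \sum_i softw i x *: bvec beta i.

(** [softZ (x + v) / softZ x] is the Gibbs average of the [expR (u i)]. A second-order bound on each
    exponential and [ln E <= E - 1] give an expansion from below with constants uniform in [x]; the
    radius keeps every [u i] within 1/2. *)
Lemma softmin_quad_below : 0 < eps ->
  exists2 C, 0 <= C & exists2 r : R, 0 < r & forall x v, `|v| <= r ->
    softmin x + dotp (soft_grad x) v - C * `|v| ^+ 2 <= softmin (x + v).
Proof.
move=> e0; pose K : R := \sum_i \sum_j `|bvec beta i 0 j| + 1.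
have K0 : 0 < K.
  by rewrite ltr_wpDl// sumr_ge0// => i _; rewrite sumr_ge0// => j _.
have bK i v : `|dotp (bvec beta i) v| <= K * `|v|.
  apply: le_trans (norm_dotp_le _ _) _; rewrite ler_wpM2r//.
  rewrite /K [X in _ <= X + 1](bigD1 i)//= -addrA lerDl addr_ge0//.
  by apply: sumr_ge0 => k _; apply: sumr_ge0 => j _.
exists (2 * K ^+ 2 / eps); first by rewrite divr_ge0 ?mulr_ge0 ?sqr_ge0// ltW.
exists (eps / (2 * K)); first by rewrite divr_gt0 ?mulr_gt0.
move=> x v vr; pose u i := dotp (bvec beta i) v / eps.
have uK i : `|u i| <= K * `|v| / eps.
  by rewrite normrM [`|eps^-1|]gtr0_norm ?invr_gt0// ler_pM2r ?invr_gt0.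
have u2 i : `|u i| <= 2^-1.
  apply: le_trans (uK i) _; rewrite ler_pdivrMr// -ler_pdivlMl//.
  apply: le_trans vr _; rewrite le_eqVlt; apply/orP; left; apply/eqP.
  by field; rewrite !gt_eqF.
have ZE : softZ (x + v) = softZ x * \sum_i softw i x * expR (u i).
  rewrite mulr_sumr; apply: eq_bigr => i _.
  rewrite /softw mulrA [softZ x * _]mulrC divfK ?gt_eqF ?softZ_gt0//.
  rewrite -expRD; congr expR; rewrite (planeB beta z i x) addrAC subrr add0r.
  by rewrite /u mulrBl opprB addrC.
set E := \sum_i _ in ZE.
have E0 : 0 < E.
  by have := softZ_gt0 (x + v); rewrite ZE pmulr_rgt0 ?softZ_gt0.
have E1 : E <= 1 - dotp (soft_grad x) v / eps + 2 * (K * `|v| / eps) ^+ 2.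
  apply: (@le_trans _ _ (\sum_i softw i x * (1 + u i + 2 * (K * `|v| / eps) ^+ 2))).
    apply: ler_sum => i _; apply: ler_wpM2l; first exact/ltW/softw_gt0.
    apply: le_trans (expR_le_quad (u2 i)) _; rewrite lerD2l ler_pM2l//.
    by rewrite -[leLHS]real_normK ?num_real// ler_sqr ?nnegrE// (le_trans _ (uK i)).
  under eq_bigr do rewrite !mulrDr mulr1.
  rewrite !big_split/= softw_sum -[X in _ + X <= _]mulr_suml softw_sum mul1r.
  rewrite /soft_grad dotpNl mulNr opprK dotp_suml mulr_suml lerD2r lerD2l.
  by apply: ler_sum => i _; rewrite dotpZl mulrA.
have : ln E <= E - 1.
  have := @le_ln1Dx R (E - 1); rewrite subrKC; apply; lra.
rewrite /softmin ZE lnM ?posrE ?softZ_gt0// => lnE.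
have : eps * ln E <=
    eps * (- dotp (soft_grad x) v / eps + 2 * (K * `|v| / eps) ^+ 2).
  by rewrite ler_pM2l//; lra.
have -> : eps * (- dotp (soft_grad x) v / eps + 2 * (K * `|v| / eps) ^+ 2) =
   - dotp (soft_grad x) v + 2 * K ^+ 2 / eps * `|v| ^+ 2.
  by field; rewrite gt_eqF.
lra.
Qed.

Lemma plane_continuous i : continuous (plane beta z i).
Proof.
have -> : plane beta z i = fun x => dotp (bvec beta i) z - dotp (bvec beta i) x.
  by apply/funext => x; rewrite /plane dotpBr.
move=> x; apply: (@continuousB R R^o 'rV[R]_n.+1 (cst _) (dotp _)).
  exact: cst_continuous.
exact: dotp_continuous.
Qed.

Lemma softmin_continuous : continuous softmin.
Proof.
have Zc : continuous softZ.
  apply: (continuous_big (op := +%R)); first exact: add_continuous.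
  move=> i _ x; apply: (@continuous_comp 'rV[R]_n.+1 R R _ expR); last first.
    exact: continuous_expR.
  apply: (@continuousN R R^o 'rV[R]_n.+1).
  apply: (@continuousM R 'rV[R]_n.+1); first exact: plane_continuous.
  exact: cst_continuous.
move=> x; apply: (@continuousN R R^o 'rV[R]_n.+1).
apply: (@continuousM R 'rV[R]_n.+1); first exact: cst_continuous.
apply: (@continuous_comp 'rV[R]_n.+1 R R softZ (@ln R)); first exact: Zc.
exact/continuous_ln/softZ_gt0.
Qed.

End SoftMin.

(** * The one-dimensional barrier profile *)

Section Hinge.
Context {R : realType}.
Implicit Types s h : R.

Definition hinge s : R := Num.max 0 s.

Definition hinge_int s : R := hinge s ^+ 2 / 2.

Lemma hinge_ge0 s : 0 <= hinge s.
Proof. by rewrite le_max lexx. Qed.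

Lemma hinge_le1 s : s <= 1 -> hinge s <= 1.
Proof. by rewrite ge_max ler01. Qed.

Lemma hinge_gt0 s : 0 < hinge s -> 0 < s.
Proof. by rewrite lt_max ltxx. Qed.

Lemma hinge_npos s : s <= 0 -> hinge s = 0.
Proof. exact: max_l. Qed.

Lemma hinge_int_ge0 s : 0 <= hinge_int s.
Proof. by rewrite divr_ge0// sqr_ge0. Qed.

Lemma hinge_int_le1 s : s <= 1 -> hinge_int s <= 1.
Proof.
move=> /hinge_le1 s1; rewrite /hinge_int ler_pdivrMr// mul1r.
have : hinge s ^+ 2 <= 1 by rewrite expr_le1// hinge_ge0.
by lra.
Qed.

Lemma hinge_int_quad s h :
  hinge_int (s + h) <= hinge_int s + hinge s * h + h ^+ 2 / 2.
Proof.
rewrite /hinge_int /hinge.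
by case: (leP 0 (s + h)) => sh; case: (leP 0 s) => s0; nra.
Qed.

Lemma hinge_int_continuous : continuous hinge_int.
Proof.
have hc : continuous hinge.
  move=> x; apply: (@continuous_max R R (cst 0) id); first exact: cst_continuous.
  exact: cvg_id.
by move=> x; apply: cvgM; [apply: cvgM; exact: hc|exact: cvg_cst].
Qed.

End Hinge.

(** * Soft minimum minus barriers *)

Section Approximant.
Context {R : realType} {n : nat}.
Variables (beta : 'I_n.+1 -> R) (z : 'rV[R]_n.+1) (eps th L kap : R).
Implicit Types (x y v : 'rV[R]_n.+1) (i j k : 'I_n.+1).

Let B : R := \sum_i beta i.

(** The face of the first coordinate carries the boundary value 0, so no steep decrease is wanted
    there. *)
Definition top_slope j : R := if j == ord0 then 0 else L.

(** Consecutive slopes drop by [B + 1], which beats the at most [B] contributed by the soft minimum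
    to a product with [gamma]. A natural number as argument allows [k = n.+1], where the slope is
    0. *)
Definition bottom_slope (k : nat) : R := (n.+1 - k)%:R * (B + 1).

Definition push_top j x : R := top_slope j * hinge (1 - (z 0 j - x 0 j) / kap).

Definition push_bottom j x : R := bottom_slope j * hinge (1 - x 0 j / kap).

(** An antiderivative in [s] of [push_top - push_bottom], of size at most proportional to [kap] on
    the box. *)
Definition barrier j (s : R) : R :=
  top_slope j * kap * hinge_int (1 - (z 0 j - s) / kap) +
  bottom_slope j * kap * hinge_int (1 - s / kap).

Definition approximant x : R := th * softmin beta z eps x - \sum_j barrier j (x 0 j).

Definition approximant_grad x : 'rV[R]_n.+1 :=
  th *: soft_grad beta z eps x - \row_j (push_top j x - push_bottom j x).

Lemma beta_le_sum i : (forall i, 0 < beta i) -> beta i <= B.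
Proof.
move=> b0; rewrite /B (bigD1 i)//= lerDl.
by apply: sumr_ge0 => j _; exact: ltW.
Qed.

Lemma beta_sum_ge0 : (forall i, 0 < beta i) -> 0 <= B.
Proof. by move=> b0; apply: sumr_ge0 => i _; exact: ltW. Qed.

Lemma top_slope_ge0 j : 0 <= L -> 0 <= top_slope j.
Proof. by rewrite /top_slope; case: ifP. Qed.

Lemma bottom_slope_ge0 (k : nat) : (forall i, 0 < beta i) -> 0 <= bottom_slope k.
Proof. by move=> /beta_sum_ge0 b0; rewrite mulr_ge0//; lra. Qed.

Lemma push_top_ge0 j x : 0 <= L -> 0 <= push_top j x.
Proof. by move=> L0; rewrite mulr_ge0 ?top_slope_ge0 ?hinge_ge0. Qed.

Lemma push_bottom_ge0 j x : (forall i, 0 < beta i) -> 0 <= push_bottom j x.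
Proof. by move=> b0; rewrite mulr_ge0 ?bottom_slope_ge0 ?hinge_ge0. Qed.

Lemma barrier_quad j x (h : R) : 0 < kap -> 0 <= L -> (forall i, 0 < beta i) ->
  barrier j (x 0 j + h) <= barrier j (x 0 j) +
    (push_top j x - push_bottom j x) * h +
    (top_slope j + bottom_slope j) / (2 * kap) * h ^+ 2.
Proof.
move=> k0 L0 b0; rewrite /barrier /push_top /push_bottom.
have -> : 1 - (z 0 j - (x 0 j + h)) / kap = 1 - (z 0 j - x 0 j) / kap + h / kap.
  by ring.
have -> : 1 - (x 0 j + h) / kap = 1 - x 0 j / kap + - (h / kap) by ring.
have := hinge_int_quad (1 - (z 0 j - x 0 j) / kap) (h / kap).
have := hinge_int_quad (1 - x 0 j / kap) (- (h / kap)).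
move: (1 - (z 0 j - x 0 j) / kap) (1 - x 0 j / kap) => s1 s2 h2 h1.
have tk : 0 <= top_slope j * kap by rewrite mulr_ge0 ?top_slope_ge0// ltW.
have bk : 0 <= bottom_slope j * kap by rewrite mulr_ge0 ?bottom_slope_ge0// ltW.
apply: le_trans (lerD (ler_wpM2l tk h1) (ler_wpM2l bk h2)) _.
by rewrite le_eqVlt; apply/orP; left; apply/eqP; field; rewrite gt_eqF.
Qed.

Lemma approximant_quad_below : 0 < eps -> 0 < kap -> 0 <= L -> 0 <= th ->
  (forall i, 0 < beta i) ->
  exists2 C, 0 <= C & exists2 r : R, 0 < r & forall x v, `|v| <= r ->
    approximant x + dotp (approximant_grad x) v - C * `|v| ^+ 2 <=
    approximant (x + v).
Proof.
move=> e0 k0 L0 th0 b0.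
have [C C0 [r r0 hC]] := softmin_quad_below beta z e0.
pose D : R := \sum_j (top_slope j + bottom_slope j) / (2 * kap).
have Dj j : 0 <= (top_slope j + bottom_slope j) / (2 * kap).
  by rewrite divr_ge0 ?addr_ge0 ?top_slope_ge0 ?bottom_slope_ge0// mulr_ge0// ltW.
exists (th * C + D); first by rewrite addr_ge0 ?mulr_ge0// sumr_ge0.
exists r => // x v vr; rewrite /approximant /approximant_grad dotpBl dotpZl.
have h1 : \sum_j barrier j ((x + v) 0 j) <= \sum_j barrier j (x 0 j) +
    dotp (\row_j (push_top j x - push_bottom j x)) v + D * `|v| ^+ 2.
  rewrite /D mulr_suml /dotp -!big_split/=; apply: ler_sum => j _.
  rewrite !mxE; apply: le_trans (barrier_quad j x (v 0 j) k0 L0 b0) _.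
  rewrite lerD2l ler_wpM2l// -[leLHS]real_normK ?num_real//.
  by rewrite ler_sqr ?nnegrE// coord_le_norm.
by have := ler_wpM2l th0 (hC x v vr); lra.
Qed.

Lemma approximant_continuous : continuous approximant.
Proof.
move=> x; apply: (@continuousB R R^o 'rV[R]_n.+1
  (fun x => th * softmin beta z eps x) (fun x => \sum_j barrier j (x 0 j))).
  apply: (@continuousM R 'rV[R]_n.+1); first exact: cst_continuous.
  exact: softmin_continuous.
apply: (continuous_big (op := +%R)); first exact: add_continuous.
move=> j _ y.
apply: (@continuous_comp 'rV[R]_n.+1 R R (fun y => y 0 j) (barrier j)).
  exact: coord_continuous.
apply: cvgD; apply: cvgM; [exact: cvg_cst| |exact: cvg_cst| ].
  apply: (@continuous_comp R R R (fun s => 1 - (z 0 j - s) / kap)); last first.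
    exact: hinge_int_continuous.
  apply: cvgB; first exact: cvg_cst.
  by apply: cvgM; [apply: cvgB; [exact: cvg_cst|exact: cvg_id]|exact: cvg_cst].
apply: (@continuous_comp R R R (fun s => 1 - s / kap)); last first.
  exact: hinge_int_continuous.
apply: cvgB; first exact: cvg_cst.
by apply: cvgM; [exact: cvg_id|exact: cvg_cst].
Qed.

(** The three errors come from the factor [th], from the temperature of the soft minimum and from
    the barriers. *)
Lemma approximant_close x : 0 < eps -> 0 < kap -> 0 <= L -> 0 <= th <= 1 ->
  (forall i, 0 < beta i) -> box z x ->
  `|approximant x - minV beta z x| <= (1 - th) * (beta ord0 * z 0 ord0) +
    eps * n.+1%:R + kap * \sum_(j < n.+1) (top_slope j + bottom_slope j).
Proof.
move=> e0 k0 L0 /andP[th0 th1] b0 xb.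
have h1 := softmin_le beta z x e0; have h2 := softmin_ge beta z x e0.
have V0 := minV_ge0 b0 xb.
have V1 : minV beta z x <= beta ord0 * z 0 ord0.
  apply: le_trans (minV_le_ord0 _ _ _) _; rewrite ler_pM2l//.
  by have := xb ord0; lra.
have bs0 : 0 <= \sum_j barrier j (x 0 j).
  apply: sumr_ge0 => j _; rewrite addr_ge0// mulr_ge0 ?hinge_int_ge0//.
    by rewrite mulr_ge0 ?top_slope_ge0// ltW.
  by rewrite mulr_ge0 ?bottom_slope_ge0// ltW.
have bs1 : \sum_j barrier j (x 0 j) <=
    kap * \sum_(j < n.+1) (top_slope j + bottom_slope j).
  rewrite mulr_sumr; apply: ler_sum => j _; rewrite mulrDr.
  have xj := xb j; apply: lerD; rewrite mulrC [kap * _]mulrC ler_piMl//.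
  - by rewrite mulr_ge0 ?top_slope_ge0// ltW.
  - by apply: hinge_int_le1; rewrite gerBl; apply: divr_ge0; lra.
  - by rewrite mulr_ge0 ?bottom_slope_ge0// ltW.
  - by apply: hinge_int_le1; rewrite gerBl; apply: divr_ge0; lra.
rewrite /approximant ler_norml.
have th2 : th * (eps * n.+1%:R) <= eps * n.+1%:R.
  by rewrite ler_piMl// mulr_ge0 ?ltW.
have := ler_wpM2l th0 h1; have := ler_wpM2l th0 h2; rewrite mulrBr.
have : 0 <= (1 - th) * (beta ord0 * z 0 ord0 - minV beta z x).
  by rewrite mulr_ge0//; lra.
have : 0 <= (1 - th) * minV beta z x by rewrite mulr_ge0//; lra.
have : 0 <= (1 - th) * (beta ord0 * z 0 ord0) by rewrite mulr_ge0//; lra.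
have : 0 <= eps * n.+1%:R by rewrite mulr_ge0// ltW.
lra.
Qed.

End Approximant.

(** * Gradients of the approximants *)

Section ApproximantGradient.
Context {R : realType} {n : nat}.
Variables (beta : 'I_n.+1 -> R) (z : 'rV[R]_n.+1) (eps th L kap : R).
Implicit Types (x y v : 'rV[R]_n.+1) (i j k : 'I_n.+1).

Local Notation grad := (approximant_grad beta z eps th L kap).
Local Notation pt := (push_top z L kap).
Local Notation pb := (push_bottom beta kap).
Local Notation w := (softw beta z eps).

(** By duality only the i-th plane survives. Up to sign, this is a mass [th * w i x * beta i] at
    site [i] with [push_top] carrying mass rightwards into its index and [push_bottom] carrying it
    leftwards out of its index. *)
Lemma approximant_grad_gamma i x : dotp (grad x) (gamma i) =
  - (th * (w i x * beta i)) - (pt i x - pb i x) +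
  (if (i < n)%N then pt (inord i.+1) x - pb (inord i.+1) x else 0).
Proof.
rewrite /approximant_grad dotpBl dotpZl /soft_grad dotpNl dotp_suml.
rewrite (bigD1 i)//= big1 => [|k ki].
  rewrite dotpZl dotp_bvec_gamma eqxx mulr1 dotp_gamma !mxE.
  by case: ifP => _; ring.
by rewrite dotpZl dotp_bvec_gamma eq_sym (negbTE ki) !mulr0.
Qed.

Lemma approximant_grad_coord j x : grad x 0 j =
  - (th * \sum_k w k x * bvec beta k 0 j) - (pt j x - pb j x).
Proof.
rewrite !mxE summxE; congr (_ - _); rewrite mulrN; congr (- (_ * _)).
by apply: eq_bigr => k _; rewrite mxE.
Qed.

Lemma push_bottom_max j x : 0 < kap -> (forall i, 0 < beta i) -> 0 <= x 0 j ->
  pb j x <= bottom_slope beta j.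
Proof.
move=> k0 b0 xj; rewrite ler_piMr ?bottom_slope_ge0// hinge_le1//.
by rewrite gerBl; apply: divr_ge0; lra.
Qed.

Lemma approximant_grad_bottom j x : 0 < kap -> 0 <= L -> 0 <= th <= 1 ->
  (forall i, 0 < beta i) -> (forall i, 2 * kap <= z 0 i) -> box z x ->
  x 0 j = 0 -> 0 < dotp (grad x) (gamma j).
Proof.
move=> k0 L0 /andP[th0 th1] b0 zk xb xj; rewrite approximant_grad_gamma.
have -> : pt j x = 0.
  rewrite /push_top hinge_npos ?mulr0// xj subr0 subr_le0 ler_pdivlMr// mul1r.
  by have := zk j; lra.
have -> : pb j x = bottom_slope beta j.
  by rewrite /push_bottom xj mul0r subr0 /hinge max_r ?mulr1.
set B := \sum_i beta i.
have B0 : 0 <= B by exact: beta_sum_ge0.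
have uB : th * (w j x * beta j) <= B.
  apply: le_trans (beta_le_sum j b0).
  have wb : 0 <= w j x * beta j by rewrite mulr_ge0// ltW// softw_gt0.
  apply: (@le_trans _ _ (w j x * beta j)); first by rewrite ler_piMl.
  by rewrite ler_piMl ?softw_le1// ltW.
(* At [x 0 j = 0] the bottom push is full. The gap [B + 1] to the next slope covers the soft minimum
   and leaves a margin of 1. *)
have bE : bottom_slope beta j = bottom_slope beta j.+1 + (B + 1).
  rewrite /bottom_slope subSn; last by rewrite -ltnS.
  by rewrite subSS -natr1 -/B; ring.
case: ifP => jn.
  have := push_bottom_max (x := x) (j := inord j.+1) k0 b0.
  have := xb (inord j.+1) => /andP[-> _] /(_ isT).
  have := push_top_ge0 z kap (inord j.+1) x L0.
  rewrite inordK//; lra.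
have := bottom_slope_ge0 j.+1 b0; lra.
Qed.

Lemma approximant_grad_top j x : 0 < kap -> 0 <= L -> 0 <= th ->
  (forall i, 0 < beta i) -> 2 * kap <= z 0 j ->
  j != ord0 -> x 0 j = z 0 j -> grad x 0 j <= - L.
Proof.
move=> k0 L0 th0 b0 zk j0 xj; rewrite approximant_grad_coord.
have -> : pt j x = L.
  rewrite /push_top /top_slope (negbTE j0) xj subrr mul0r subr0.
  by rewrite /hinge max_r ?mulr1.
have -> : pb j x = 0.
  rewrite /push_bottom hinge_npos ?mulr0// xj subr_le0 ler_pdivlMr// mul1r; lra.
have : 0 <= th * \sum_k w k x * bvec beta k 0 j.
  rewrite mulr_ge0// sumr_ge0// => k _; rewrite bvec_coord.
  by apply: mulr_ge0; [exact/ltW/softw_gt0|rewrite mulr_ge0// ltW].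
lra.
Qed.

Lemma approximant_grad_ord0 x : grad x 0 ord0 =
  pb ord0 x - th * \sum_k w k x * beta k.
Proof.
rewrite approximant_grad_coord /push_top /top_slope eqxx mul0r.
rewrite (eq_bigr (fun k => w k x * beta k)); first by ring.
by move=> k _; rewrite bvec_coord mulr1.
Qed.

(* Mass sitting at index [k] can only be transported to indices of slack at most
   [level x k]; [potential] is the largest cost [1 / beta] it can have there.  The
   staggered term of [level] absorbs the thickness [kap] of the layers, so that
   the potential never increases along a transport. *)
Definition potential x (t : R) : R :=
  \big[Num.max/0]_(k | slack z k x <= t) (beta k)^-1.

Definition level x (k : nat) : R :=
  slack z (inord k) x + (n.+1 - k)%:R * kap.

Lemma potential_ge0 x t : 0 <= potential x t.
Proof. exact: bigmax_ge_id. Qed.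

Lemma potential_ge x t k : slack z k x <= t -> (beta k)^-1 <= potential x t.
Proof. by move=> kt; exact: le_bigmax_cond. Qed.

Lemma potential_homo x t t' : t <= t' -> potential x t <= potential x t'.
Proof.
move=> tt'; apply/bigmax_leP; split; first exact: potential_ge0.
by move=> k kt; apply: potential_ge; exact: le_trans tt'.
Qed.

Lemma potential_cases x t :
  potential x t = 0 \/ exists2 k, slack z k x <= t & potential x t = (beta k)^-1.
Proof.
rewrite /potential; elim/big_rec: _ => [|k m kt]; first by left.
move=> [->|[l lt ->]]; case: leP => _; [by left|by right; exists k| |].
  by right; exists l.
by right; exists k.
Qed.

(** Let the potential be attained at [m]. If [beta k <= beta m] the ratio is at most 1. Otherwise,
    with [d = beta k - beta m], plane [k] exceeds plane [m] by at least [tau * d - eps], so the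
    weight is at most [expR (1 - tau / eps * d)], and [d] times this is of order [eps / tau]. *)
Lemma weighted_potential_le x k (tau : R) : 0 < eps -> 0 <= kap -> 0 < tau ->
  (forall i, 0 < beta i) -> (\sum_i beta i) * (n.+1%:R * kap) <= eps ->
  (forall i, tau <= slack z i x) ->
  w k x * beta k * potential x (level x k) <=
  w k x + expR 1 * eps / tau * \sum_i (beta i)^-1.
Proof.
move=> e0 k0 t0 b0 Bk St.
have w0 := softw_gt0 beta z eps k x.
have binv i : 0 < (beta i)^-1 by rewrite invr_gt0.
have tail0 : 0 <= expR 1 * eps / tau * \sum_i (beta i)^-1.
  apply: mulr_ge0; first by rewrite !mulr_ge0 ?expR_ge0 ?invr_ge0// ltW.
  by apply: sumr_ge0 => i _; rewrite ltW.
case: (potential_cases x (level x k)) => [->|[m mt ->]].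
  by rewrite mulr0 addr_ge0// ltW.
have [bkm|bmk] := leP (beta k) (beta m).
  rewrite -mulrA (le_trans (y := w k x))//; last by rewrite lerDl.
  by apply: ler_piMr; [exact: ltW|rewrite ler_pdivrMr// mul1r].
set d := beta k - beta m.
have d0 : 0 < d by rewrite subr_gt0.
have -> : w k x * beta k * (beta m)^-1 = w k x + d * w k x * (beta m)^-1.
  by rewrite /d; field; rewrite gt_eqF.
rewrite lerD2l; apply: ler_pM.
- by rewrite mulr_ge0// ltW.
- exact: ltW.
- apply: (@le_trans _ _ (d * expR (1 - tau / eps * d))); last first.
    rewrite expRD mulrCA -[expR 1 * eps / tau]mulrA ler_pM2l ?expR_gt0//.
    have := @ler_expR_mul R (tau / eps) d (divr_gt0 t0 e0).
    by rewrite invf_div.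
  rewrite ler_pM2l//; apply: le_trans (softw_le beta z eps k m x) _.
  rewrite ler_expR !planeE -mulNr opprB -(ler_pM2r e0) divfK ?gt_eqF//.
  have -> : (1 - tau / eps * d) * eps = eps - tau * d by field; rewrite gt_eqF.
  have mb : beta m * (n.+1%:R * kap) <= eps.
    apply: le_trans Bk; apply: ler_wpM2r; first by rewrite mulr_ge0.
    exact: beta_le_sum.
  have : beta m * slack z m x <= beta m * (slack z k x + n.+1%:R * kap).
    rewrite ler_pM2l//; apply: le_trans mt _.
    by rewrite /level inord_val lerD2l ler_wpM2r// ler_nat leq_subr.
  have := ler_wpM2l (ltW d0) (St k); rewrite /d; lra.
- by rewrite (bigD1 m)//= lerDl sumr_ge0// => i _; rewrite ltW.
Qed.

End ApproximantGradient.

Lemma subSn_pred (n k : nat) : (0 < k <= n)%N -> (n.+1 - k.-1)%N = (n.+1 - k).+1.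
Proof. lia. Qed.

(** * Positivity of the Hamiltonian along the approximants *)

Section ApproximantHamiltonian.
Context {R : realType} {n : nat}.
Variables (lam c : R) (mu beta : 'I_n.+1 -> R) (z : 'rV[R]_n.+1).
Variables (eps th L kap : R).
Implicit Types (x : 'rV[R]_n.+1) (i : 'I_n.+1).

Local Notation grad := (approximant_grad beta z eps th L kap).
Local Notation pt := (push_top z L kap).
Local Notation pb := (push_bottom beta kap).
Local Notation w := (softw beta z eps).

Lemma push_top_gt0 i x : 0 < kap -> 0 <= L -> 0 < pt i x -> z 0 i - x 0 i < kap.
Proof.
move=> k0 L0; rewrite /push_top => h.
have : 0 < hinge (1 - (z 0 i - x 0 i) / kap).
  rewrite lt_neqAle hinge_ge0 eq_sym andbT; apply: contraTneq h => ->.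
  by rewrite mulr0 ltxx.
by move=> /hinge_gt0; rewrite subr_gt0 ltr_pdivrMr// mul1r.
Qed.

Lemma push_bottom_gt0 i x : 0 < kap -> 0 < pb i x -> x 0 i < kap.
Proof.
move=> k0; rewrite /push_bottom => h.
have : 0 < hinge (1 - x 0 i / kap).
  rewrite lt_neqAle hinge_ge0 eq_sym andbT; apply: contraTneq h => ->.
  by rewrite mulr0 ltxx.
by move=> /hinge_gt0; rewrite subr_gt0 ltr_pdivrMr// mul1r.
Qed.

Lemma approximant_grad_hamR_gt0 x (tau : R) :
  0 < lam -> 0 < c -> (forall i, 0 < mu i) ->
  (forall i, positive_solution lam c (mu i) (beta i)) ->
  0 < eps -> 0 < kap -> 0 <= L -> 0 <= th < 1 -> 0 < tau ->
  (forall i, 2 * kap <= z 0 i) ->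
  (\sum_i beta i) * (n.+1%:R * kap) <= eps ->
  n.+1%:R * (expR 1 * eps / tau * \sum_i (beta i)^-1) <= 1 - th ->
  box z x -> x 0 ord0 <= z 0 ord0 - tau -> 0 < hamR lam c mu (grad x).
Proof.
move=> lam0 c0 mu0 bs e0 k0 L0 /andP[th0 th1] t0 zk Bk Tk xb xt.
have b0 i : 0 < beta i by exact: (bs i).1.
pose u k := th * (w (inord k) x * beta (inord k)).
pose tr (k : nat) := if (k <= n)%N then pt (inord k) x else 0.
pose tl (k : nat) := if (k <= n)%N then pb (inord k) x else 0.
pose pi k := potential beta z x (level z kap x k).
have u0 k : 0 <= u k.
  apply: mulr_ge0 => //; apply: mulr_ge0; [exact/ltW/softw_gt0|exact: ltW].
have tl0 k : 0 <= tl k by rewrite /tl; case: ifP; rewrite ?push_bottom_ge0.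
have tr0 k : 0 <= tr k by rewrite /tr; case: ifP; rewrite ?push_top_ge0.
have tlr k : 0 < tl k -> tr k = 0.
  rewrite /tl /tr; case: ifP => // _ /(push_bottom_gt0 k0) xk.
  apply/eqP; rewrite -[_ == 0]negbK; apply/negP => tk.
  have : 0 < pt (inord k) x by rewrite lt_neqAle push_top_ge0// eq_sym tk.
  by move=> /(push_top_gt0 k0 L0); have := zk (inord k); lra.
have i0 : inord 0 = ord0 :> 'I_n.+1 by apply/val_inj; rewrite /= inordK.
have [] := @capped_redistribution R n u pi tl tr u0 tl0 tr0 tlr.
- by rewrite /tr/= i0 /push_top /top_slope eqxx mul0r.
- by rewrite /tr ltnn.
- by rewrite /tl ltnn.
- exact: potential_ge0.
(* A rightward edge has [z_k - x_k < kap]: the slack rises by less than [kap] and the stagger drops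
   by [kap], so the level does not rise. *)
- move=> k kn; have [k1 k2] := andP kn.
  rewrite /tr k2 => /(push_top_gt0 k0 L0) h; apply: potential_homo.
  rewrite /level slack_inord//.
  rewrite subSn_pred//.
  by rewrite -natr1; lra.
(* A leftward edge has [x_k < kap], hence [z_k - x_k > kap] as [z_k >= 2 kap], and the level does
   not rise towards [k - 1]. *)
- move=> k kn; have [k1 k2] := andP kn.
  rewrite /tl k2 => /(push_bottom_gt0 k0) h; apply: potential_homo.
  rewrite /level [slack z (inord k) x]slack_inord//.
  rewrite subSn_pred//.
  by have := zk (inord k); rewrite -natr1; lra.
move=> m [m0 mS mP].
(* The cost is at most [th] times the sum of the Gibbs weights, 1, plus all tails, at most [1 - th];
   so [1 - s] is the square of [1 - th]. *)
pose s := th * (1 + (1 - th)).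
have s1 : 0 < 1 - s.
  have -> : 1 - s = (1 - th) ^+ 2 by rewrite /s; ring.
  by rewrite exprn_gt0// subr_gt0.
have s1' : s <= 1 by rewrite -subr_ge0 ltW.
apply: (@lt_le_trans _ _ ((1 - s) * c)); first by rewrite mulr_gt0.
apply: (hamR_lower_bound (w := fun i => m i) lam0 c0 mu0 s1' bs).
- move=> i; have := m0 i; rewrite -ltnS ltn_ord => /(_ isT).
  rewrite dotpC approximant_grad_gamma /u /tr /tl inord_val -ltnS ltn_ord.
  set a := _ + _ - _; set b := - (_ + _).
  suff -> : a = b by [].
  by rewrite /a /b; case: ifP => _; ring.
(* The loss [tl 0] at the left end is exactly the bottom push in the first coordinate of the
   gradient. *)
- rewrite approximant_grad_ord0 opprB; apply: le_trans mS.
  rewrite /tl/= i0 lerD2r /u -mulr_sumr ler_wpM2l//.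
  by apply: ler_sum => i _; rewrite inord_val.
- apply: le_trans (le_trans mP _).
    apply: ler_sum => i _; rewrite mulrC ler_wpM2r//.
      by have /andP[] := m0 i ltac:(by rewrite -ltnS ltn_ord).
    apply: potential_ge; rewrite /level inord_val lerDl.
    by rewrite mulr_ge0// ltW.
  set T := expR 1 * eps / tau * \sum_i (beta i)^-1 in Tk.
  apply: (@le_trans _ _ (\sum_(i < n.+1) th * (w i x + T))).
    apply: ler_sum => i _; rewrite /u inord_val /pi mulrC -mulrA ler_wpM2l//.
    apply: weighted_potential_le => //; first exact: ltW.
    by move=> k; apply: le_trans (slack_ge k xb); lra.
  rewrite -mulr_sumr big_split/= softw_sum sumr_const card_ord -[T *+ _]mulr_natl.
  by rewrite /s ler_wpM2l// lerD2l.
Qed.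

End ApproximantHamiltonian.

Section ApproximantExistence.
Context {R : realType} {n : nat}.
Variables (lam c : R) (mu beta : 'I_n.+1 -> R) (z : 'rV[R]_n.+1).
Implicit Types (x v : 'rV[R]_n.+1) (i : 'I_n.+1).

(** The parameters are fixed in the order [d = 1 - th], [eps], [kap], each small with respect to the
    previous ones, and each spends a third of [zeta]. *)
Lemma strict_subsolution_approximation (L tau zeta : R) :
  0 < lam -> 0 < c -> (forall i, 0 < mu i) -> (forall i, 0 < z 0 i) ->
  (forall i, positive_solution lam c (mu i) (beta i)) ->
  0 <= L -> 0 < tau -> 0 < zeta ->
  exists (phi : 'rV[R]_n.+1 -> R) (D : 'rV[R]_n.+1 -> 'rV[R]_n.+1),
  [/\ continuous phi,
      exists2 C, 0 <= C & exists2 r : R, 0 < r & forall x v, `|v| <= r ->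
        phi x + dotp (D x) v - C * `|v| ^+ 2 <= phi (x + v),
      forall x, box z x -> `|phi x - minV beta z x| <= zeta &
      forall x, box z x -> x 0 ord0 <= z 0 ord0 - tau ->
        [/\ 0 < hamR lam c mu (D x),
            forall i, x 0 i = 0 -> 0 < dotp (D x) (gamma i) &
            forall i, i != ord0 -> x 0 i = z 0 i -> D x 0 i <= - L]].
Proof.
move=> lam0 c0 mu0 z0 bs L0 t0 ze0.
have b0 i : 0 < beta i by exact: (bs i).1.
pose N : R := n.+1%:R; have N0 : 0 < N by [].
pose B := \sum_i beta i.
have B0 : 0 < B.
  by rewrite /B (bigD1 ord0)//= ltr_pwDl// sumr_ge0// => i _; rewrite ltW.
pose Binv := \sum_i (beta i)^-1.
have Binv0 : 0 < Binv.
  rewrite /Binv (bigD1 ord0)//= ltr_pwDl ?invr_gt0// sumr_ge0// => i _.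
  by rewrite invr_ge0 ltW.
pose V0 := beta ord0 * z 0 ord0; have V00 : 0 < V0 by rewrite mulr_gt0.
pose d : R := Num.min (2^-1) (zeta / (3 * V0)).
have d0 : 0 < d by rewrite lt_min invr_gt0 ltr0n/= divr_gt0// mulr_gt0.
have d1 : d <= 2^-1 by rewrite ge_min lexx.
have dV : d * V0 <= zeta / 3.
  have -> : zeta / 3 = zeta / (3 * V0) * V0 by field; rewrite gt_eqF.
  by rewrite ler_pM2r// ge_min lexx orbT.
pose Q := N * (expR 1 / tau * Binv).
have Q0 : 0 < Q by rewrite !mulr_gt0 ?expR_gt0 ?invr_gt0.
(* The second bound makes the tails of all Gibbs weights fit into [1 - th = d]. *)
pose eps := Num.min (zeta / (3 * N)) (d / Q).
have e0 : 0 < eps by rewrite lt_min !divr_gt0// mulr_gt0.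
have eN : eps * N <= zeta / 3.
  have -> : zeta / 3 = zeta / (3 * N) * N by field; rewrite gt_eqF.
  by rewrite ler_pM2r// ge_min lexx.
have eQ : eps * Q <= d.
  by rewrite -ler_pdivlMr//; rewrite ge_min lexx orbT.
pose Sl : R := \sum_(j < n.+1) (top_slope L j + bottom_slope beta j).
have Sl0 : 0 <= Sl.
  by apply: sumr_ge0 => j _; rewrite addr_ge0 ?top_slope_ge0 ?bottom_slope_ge0.
pose zmin := \big[Num.min/z 0 ord0]_i z 0 i.
have zm0 : 0 < zmin.
  by rewrite /zmin; elim/big_ind: _ => // a b a0 b0'; rewrite lt_min a0.
(* In turn: disjoint layers, a stagger of the levels costing at most [eps], and barriers of height
   at most [zeta / 3]. *)
pose kap := Num.min (zmin / 2) (Num.min (eps / (B * N)) (zeta / (3 * (Sl + 1)))).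
have k0 : 0 < kap.
  rewrite !lt_min !divr_gt0 ?mulr_gt0//; lra.
have kz i : 2 * kap <= z 0 i.
  have : kap <= zmin / 2 by rewrite ge_min lexx.
  have : zmin <= z 0 i by exact: bigmin_le_cond.
  lra.
have kB : B * (N * kap) <= eps.
  rewrite mulrA mulrC -ler_pdivlMr ?mulr_gt0//.
  by rewrite !ge_min lexx !orbT.
have kS : kap * Sl <= zeta / 3.
  have S1 : 0 < Sl + 1 by lra.
  have -> : zeta / 3 = zeta / (3 * (Sl + 1)) * (Sl + 1) by field; rewrite gt_eqF.
  have h : kap <= zeta / (3 * (Sl + 1)) by rewrite !ge_min lexx !orbT.
  apply: (@le_trans _ _ (kap * (Sl + 1))); first by rewrite ler_pM2l// lerDl.
  by rewrite ler_pM2r.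
have th01 : 0 <= 1 - d <= 1 by lra.
exists (approximant beta z eps (1 - d) L kap).
exists (approximant_grad beta z eps (1 - d) L kap).
split.
- exact: approximant_continuous.
- by apply: approximant_quad_below => //; lra.
- move=> x xb; apply: le_trans (approximant_close e0 k0 L0 th01 b0 xb) _.
  rewrite -/V0 -/N -/Sl; lra.
- move=> x xb xt; split.
  + apply: approximant_grad_hamR_gt0 xt => //; first by lra.
    rewrite -/N -/Binv opprB addrC subrK; apply: le_trans eQ.
    by rewrite /Q le_eqVlt; apply/orP; left; apply/eqP; ring.
  + by move=> i xi; apply: approximant_grad_bottom.
  + by move=> i i0 xi; apply: approximant_grad_top => //; lra.
Qed.

End ApproximantExistence.

(** * Comparison with the candidate *)

Section Comparison.
Context {R : realType} {n : nat}.
Variables (lam c : R) (mu beta : 'I_n.+1 -> R) (z : 'rV[R]_n.+1).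
Implicit Types (x y v p : 'rV[R]_n.+1) (i k : 'I_n.+1) (W : 'rV[R]_n.+1 -> R).

Lemma big_mine_gt0 (P : pred 'I_n.+1) (F : 'I_n.+1 -> R) :
  (forall i, P i -> 0 < F i) -> (0 < \big[mine/+oo]_(i | P i) (F i)%:E)%E.
Proof.
move=> F0; elim/big_ind: _ => [|a b a0 b0|i /F0]; first exact: lt0y.
  by rewrite lt_min a0.
by rewrite lte_fin.
Qed.

Lemma big_maxe_lt0 (P : pred 'I_n.+1) (F : 'I_n.+1 -> R) :
  (forall i, P i -> F i < 0) -> (\big[maxe/-oo]_(i | P i) (F i)%:E < 0)%E.
Proof.
move=> F0; elim/big_ind: _ => [|a b a0 b0|i /F0]; first exact: ltNy0.
  by rewrite gt_max a0.
by rewrite lte_fin.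
Qed.

Lemma box_nonempty : (forall i, 0 < z 0 i) -> box z !=set0.
Proof. by move=> z0; exists z => i; rewrite lexx ltW ?z0. Qed.

(** Steepening by [d] makes the balance negative. The tilt [eta], present at every index so that all
    products with [gamma] are strictly negative, raises the service terms by at most
    [eta * \sum_k mu k]. *)
Lemma tilted_hamR_lt0 i (d eta : R) (w : 'I_n.+1 -> R) :
  0 < lam -> (forall k, 0 < mu k) ->
  0 < beta i -> 0 < d -> 0 < eta ->
  eta * \sum_k mu k < - balance lam c (mu i) (beta i + d) ->
  (forall k, w k = (beta i + d) * (k == i)%:R + eta) ->
  hamR lam c mu (- \sum_k bvec w k) < 0.
Proof.
move=> lam0 mu0 b0 d0 e0 he wE.
have w0 k : 0 < w k by rewrite wE ltr_wpDl// mulr_ge0//; lra.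
rewrite /hamR.
have -> : - (- \sum_k bvec w k) 0 ord0 = \sum_k w k.
  rewrite mxE opprK summxE; apply: eq_bigr => k _.
  by rewrite bvec_coord mulr1.
have gE k : dotp (gamma k) (- \sum_k bvec w k) = - w k.
  rewrite dotpC dotpNl dotp_suml (bigD1 k)//= big1 => [|j jk].
    by rewrite dotp_bvec_gamma eqxx mulr1 addr0.
  by rewrite dotp_bvec_gamma eq_sym (negbTE jk) mulr0.
have h1 : beta i + d <= \sum_k w k.
  rewrite (bigD1 i)//= wE eqxx mulr1 -addrA lerDl.
  apply: addr_ge0; first exact: ltW.
  by apply: sumr_ge0 => k _; exact: ltW.
have h2 : \sum_k Num.max 0 (mu k * (1 - expR (dotp (gamma k) (- \sum_k bvec w k))))
    <= mu i * (1 - expR (- (beta i + d))) + eta * \sum_k mu k.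
  have -> : mu i * (1 - expR (- (beta i + d))) =
      \sum_k mu k * (1 - expR (- ((beta i + d) * (k == i)%:R))).
    rewrite (bigD1 i)//= eqxx mulr1 big1 ?addr0// => k ki.
    by rewrite (negbTE ki) mulr0 oppr0 expR0 subrr mulr0.
  rewrite mulr_sumr -big_split/=; apply: ler_sum => k _.
  rewrite gE max_r; last first.
    by rewrite mulr_ge0 ?ltW// subr_gt0 expR_lt1 oppr_lt0.
  rewrite [eta * _]mulrC -mulrDr ler_pM2l// wE opprD expRD.
  set a := expR (- (_ * _)).
  have a1 : a <= 1.
    by rewrite expR_le1 oppr_le0 mulr_ge0//; lra.
  have a0 : 0 <= a by exact: expR_ge0.
  have := one_sub_expRN_le eta; have : expR (- eta) <= 1 by rewrite expR_le1; lra.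
  nra.
have h3 : lam * (1 - expR (\sum_k w k)) <= lam * (1 - expR (beta i + d)).
  by rewrite ler_pM2l// lerD2l lerN2 ler_expR.
move: he; rewrite /balance; lra.
Qed.

Lemma subsolution_le_minV W : 0 < lam -> 0 < c -> (forall i, 0 < mu i) ->
  (forall i, 0 < z 0 i) ->
  (forall i, positive_solution lam c (mu i) (beta i)) ->
  {within box z, continuous W} ->
  (forall x p, domG z x -> Dplus z W x p ->
    (0 <= maxe (Ham lam c mu p)
               (\big[maxe/-oo]_(i in Iset x) (dotp p (gamma i))%:E))%E) ->
  (forall x, boundary_o z x -> W x = 0) ->
  forall x, box z x -> W x <= minV beta z x.
Proof.
move=> lam0 c0 mu0 z0 bs cW hW W0 x xb.
have [i ->] := minV_attained beta z x.
have bi : 0 < beta i by exact: (bs i).1.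
pose Cx := slack z i x + \sum_k slack z k x.
have Cx0 : 0 <= Cx.
  rewrite addr_ge0 ?slack_ge0//.
  by apply: sumr_ge0 => k _; exact: slack_ge0.
(* Steepening and tilting by at most [d] raise the plane at [x] by at most [d * Cx], which is below
   [e]. *)
apply/ler_addgt0Pr => e e0; pose d := e / (Cx + 1).
have d0 : 0 < d by rewrite divr_gt0//; lra.
have bal : balance lam c (mu i) (beta i + d) < 0.
  by apply: balance_lt0 (bs i) _ => //; rewrite ltrDl.
pose M := \sum_k mu k.
have M0 : 0 < M.
  by rewrite /M (bigD1 i)//= ltr_pwDl// sumr_ge0// => k _; exact: ltW.
pose eta := Num.min d (- balance lam c (mu i) (beta i + d) / (2 * M)).
have eta0 : 0 < eta.
  by rewrite lt_min d0 divr_gt0 ?oppr_gt0 ?mulr_gt0.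
have etad : eta <= d by rewrite ge_min lexx.
have etaM : eta * M < - balance lam c (mu i) (beta i + d).
  have h : eta <= - balance lam c (mu i) (beta i + d) / (2 * M).
    by rewrite ge_min lexx orbT.
  apply: (@le_lt_trans _ _ (- balance lam c (mu i) (beta i + d) / (2 * M) * M)).
    by rewrite ler_pM2r.
  have -> : - balance lam c (mu i) (beta i + d) / (2 * M) * M =
    - balance lam c (mu i) (beta i + d) / 2 by field; rewrite gt_eqF.
  lra.
pose w k := (beta i + d) * (k == i)%:R + eta.
pose lin y := \sum_k plane w z k y.
have w0 k : 0 < w k by rewrite ltr_wpDl// mulr_ge0//; lra.
have lin0 y : box z y -> 0 <= lin y.
  move=> yb; apply: sumr_ge0 => k _.
  by rewrite planeE mulr_ge0 ?slack_ge0// ltW.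
have linB y y' : lin y' = lin y + dotp (- \sum_k bvec w k) (y' - y).
  rewrite /lin dotpNl dotp_suml -sumrB; apply: eq_bigr => k _.
  exact: planeB.
have linx : lin x <= beta i * slack z i x + e.
  apply: (@le_trans _ _ (beta i * slack z i x + d * Cx)); last first.
    rewrite lerD2l /d mulrAC ler_pdivrMr; last by lra.
    by rewrite ler_pM2l//; lra.
  rewrite /lin /Cx (bigD1 i)//= planeE /w eqxx mulr1.
  rewrite (eq_bigr (fun k => eta * slack z k x)) => [|k ki]; last first.
    by rewrite planeE (negbTE ki) mulr0 add0r.
  rewrite -mulr_sumr [\sum_k slack z k x](bigD1 i)//=.
  have s0 := slack_ge0 i xb.
  have S0 : 0 <= \sum_(k | k != i) slack z k x.
    by apply: sumr_ge0 => k _; exact: slack_ge0.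
  nra.
rewrite planeE; apply: le_trans linx.
have cf : {within box z, continuous (W - lin)}.
  apply: within_continuousB => //; apply: continuous_subspaceT.
  apply: (continuous_big (op := +%R)); first exact: add_continuous.
  by move=> k _; exact: plane_continuous.
have [y] := compact_EVT_max (box_nonempty z0) (@box_compact _ _ z) cf.
rewrite inE => yb ymax.
have {}ymax t : box z t -> W t - lin t <= W y - lin y.
  by move=> tb; apply: ymax; rewrite inE.
suff : W y - lin y <= 0 by have := ymax x xb; lra.
have [yz|yz] := leP (z 0 ord0) (y 0 ord0).
  rewrite W0 ?sub0r ?oppr_le0 ?lin0//; split=> [|k _]; last exact: yb.
  by apply/eqP; rewrite eq_le yz andbT; case/andP: (yb ord0).
(* The function [lin] touches W from above at [y] up to a constant, so its gradient lies in D^+ W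
   and violates both alternatives. *)
exfalso; have Dy : Dplus z W y (- \sum_k bvec w k).
  apply/(DplusP z0) => d' d'0; exists 1 => // t tb _.
  have := ymax t tb; rewrite (linB y t).
  have : 0 <= d' * `|t - y| by rewrite mulr_ge0// ltW.
  lra.
have := hW y _ (box_domG yb yz) Dy.
apply/negP; rewrite -ltNge gt_max Ham_hamR// lte_fin.
rewrite (tilted_hamR_lt0 (i := i) (d := d) (eta := eta))//=.
apply: big_maxe_lt0 => k _; rewrite dotpNl dotp_suml oppr_lt0.
rewrite (bigD1 k)//= big1 => [|j jk].
  by rewrite dotp_bvec_gamma eqxx mulr1 addr0.
by rewrite dotp_bvec_gamma eq_sym (negbTE jk) mulr0.
Qed.

End Comparison.

(** * Lower comparison *)

Section SuperComparison.
Context {R : realType} {n : nat}.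
Variables (lam c : R) (mu beta : 'I_n.+1 -> R) (z : 'rV[R]_n.+1).
Implicit Types (x y v p : 'rV[R]_n.+1) (i k : 'I_n.+1) (W : 'rV[R]_n.+1 -> R).

Lemma supersolution_ge_minV W (K : R) : 0 < lam -> 0 < c -> (forall i, 0 < mu i) ->
  (forall i, 0 < z 0 i) ->
  (forall i, positive_solution lam c (mu i) (beta i)) ->
  0 <= K -> (forall x y, box z x -> box z y -> `|W x - W y| <= K * `|x - y|) ->
  {within box z, continuous W} ->
  (forall x p, (domG z `\` boundary_c z) x -> Dminus z W x p ->
    (mine (Ham lam c mu p)
          (\big[mine/+oo]_(i in Iset x) (dotp p (gamma i))%:E) <= 0)%E) ->
  (forall x, boundary_o z x -> W x = 0) ->
  forall x, box z x -> minV beta z x <= W x.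
Proof.
move=> lam0 c0 mu0 z0 bs K0 WK cW hW W0 x xb.
have b0 i : 0 < beta i by exact: (bs i).1.
apply/ler_addgt0Pr => e e0.
pose A := K + beta ord0.
have A0 : 0 < A by have := b0 ord0; rewrite /A; lra.
(* Within [tau] of the face where W vanishes, [W >= - K * tau] and [V <= beta ord0 * tau], so
   [W - V >= - e / 2]; twice the approximation error [e / 4] completes [e]. *)
pose tau := e / (2 * A).
have t0 : 0 < tau by rewrite divr_gt0// mulr_gt0.
have tA : tau * A = e / 2 by rewrite /tau; field; rewrite gt_eqF.
(* The slope [K + 1] exceeds the Lipschitz constant of W. *)
have L0 : 0 <= K + 1 by lra.
have ze0 : 0 < e / 4 by rewrite divr_gt0.
have [phi [D [cphi [C C0 [r r0 phiq]] phiV phiD]]] :=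
  strict_subsolution_approximation lam0 c0 mu0 z0 bs L0 t0 ze0.
have cf : {within box z, continuous (W - phi)}.
  by apply: within_continuousB => //; exact: continuous_subspaceT.
have [y] := compact_EVT_min (box_nonempty z0) (@box_compact _ _ z) cf.
rewrite inE => yb ymin.
have {}ymin t : box z t -> W y - phi y <= W t - phi t.
  by move=> tb; apply: ymin; rewrite inE.
suff h : - (e / 2) - e / 4 <= W y - phi y.
  have := ymin x xb; have := phiV x xb; rewrite ler_norml; lra.
have [yt|yt] := leP (y 0 ord0) (z 0 ord0 - tau); last first.
  pose y' := y + (z 0 ord0 - y 0 ord0) *: unitv ord0.
  have y'b : boundary_o z y'.
    split=> [|i i0]; rewrite coord_add_unitv ?eqxx ?mulr1 ?subrKC//.
    by rewrite (negbTE i0) mulr0 addr0 yb.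
  have y'box : box z y'.
    move=> i; have [->|i0] := eqVneq i ord0; last exact: y'b.2.
    by rewrite y'b.1 lexx ltW.
  have := WK y' y y'box yb; rewrite W0// sub0r normrN.
  rewrite (_ : y' - y = (z 0 ord0 - y 0 ord0) *: unitv ord0); last first.
    by rewrite addrAC subrr add0r.
  have zy : 0 <= z 0 ord0 - y 0 ord0 by have := yb ord0; lra.
  rewrite norm_scale_unitv (ger0_norm zy) => Wy.
  have Ky : K * (z 0 ord0 - y 0 ord0) <= K * tau by apply: ler_wpM2l => //; lra.
  have By : beta ord0 * (z 0 ord0 - y 0 ord0) <= beta ord0 * tau.
    by rewrite ler_pM2l//; lra.
  have := minV_le_ord0 beta z y; have := phiV y yb; rewrite ler_norml.
  move: Wy; rewrite ler_norml; move: tA; rewrite /A; lra.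
have [Hpos gpos top] := phiD y yb yt.
have y0lt : y 0 ord0 < z 0 ord0 by lra.
(* A step [h] inward from such a face raises [phi] by at least [(K + 1) * h - C * h ^+ 2] and W by
   at most [K * h], which contradicts minimality once [C * h < 1]. *)
have ync : ~ boundary_c z y.
  move=> [_ _ [i i0 yi]].
  pose h : R := Num.min r (Num.min (z 0 i) (2 * (C + 1))^-1).
  have h0 : 0 < h by rewrite !lt_min r0 z0 invr_gt0 mulr_gt0//; lra.
  have hr : h <= r by rewrite ge_min lexx.
  have hz : h <= z 0 i by rewrite !ge_min lexx orbT.
  have hC : C * h < 1.
    have hC1 : h <= (2 * (C + 1))^-1 by rewrite !ge_min lexx !orbT.
    have C1 : 0 < 2 * (C + 1) by lra.
    have : h * (2 * (C + 1)) <= 1 by rewrite -ler_pdivlMr// div1r.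
    nra.
  pose y' := y + (- h) *: unitv i.
  have y'b : box z y'.
    move=> j; rewrite coord_add_unitv; have [->|ji] := eqVneq j i.
      by rewrite mulr1 yi; lra.
    by rewrite mulr0 addr0; exact: yb.
  have nh : `|(- h) *: unitv i : 'rV[R]_n.+1| = h.
    by rewrite norm_scale_unitv normrN gtr0_norm.
  have := phiq y ((- h) *: unitv i); rewrite nh => /(_ hr).
  rewrite dotpZr dotp_unitv -/y'.
  have := ymin y' y'b; have := WK y' y y'b yb.
  rewrite (_ : y' - y = (- h) *: unitv i); last by rewrite addrAC subrr add0r.
  rewrite nh ler_norml => /andP[_ h1] h2 h3.
  have := top i i0 yi; rewrite -(ler_pM2l h0) => h4.
  have : h * 1 <= h * (C * h) by lra.
  by rewrite ler_pM2l//; lra.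
exfalso; have Dy : Dminus z W y (D y).
  apply/(DminusP z0) => d d0.
  have C1 : 0 < C + 1 by lra.
  exists (Num.min r (d / (C + 1))); first by rewrite lt_min r0 divr_gt0.
  move=> t tb; rewrite lt_min => /andP[tr td].
  have := phiq y (t - y) (ltW tr); rewrite subrKC.
  have := ymin t tb.
  have : C * `|t - y| ^+ 2 <= d * `|t - y|.
    rewrite expr2 mulrA ler_wpM2r//.
    have : (C + 1) * `|t - y| <= d by rewrite mulrC -ler_pdivlMr// ltW.
    have := normr_ge0 (t - y); lra.
  lra.
have := hW y _ (conj (box_domG yb y0lt) ync) Dy.
apply/negP; rewrite -ltNge lt_min Ham_hamR// lte_fin Hpos/=.
by apply: big_mine_gt0 => i /eqP; exact: gpos.
Qed.

End SuperComparison.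

(** * The candidate is a solution *)

Section MinPlanesDplus.
Context {R : realType} {n : nat}.
Variables (lam c : R) (mu beta : 'I_n.+1 -> R) (z : 'rV[R]_n.+1).
Implicit Types (x y v p : 'rV[R]_n.+1) (i k : 'I_n.+1).

Lemma hamR_continuous : continuous (hamR lam c mu).
Proof.
move=> p; apply: (@continuousD R R^o 'rV[R]_n.+1
  (fun p => c + lam * (1 - expR (- p 0 ord0)))
  (fun p => \sum_i Num.max 0 (mu i * (1 - expR (dotp (gamma i) p))))).
  apply: (@continuous_comp 'rV[R]_n.+1 R R (fun p => p 0 ord0)
    (fun s => c + lam * (1 - expR (- s)))); first exact: coord_continuous.
  apply: cvgD; first exact: cvg_cst.
  apply: cvgM; first exact: cvg_cst.
  apply: cvgB; first exact: cvg_cst.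
  apply: (@continuous_comp R R R -%R expR); last exact: continuous_expR.
  exact: opp_continuous.
apply: (continuous_big (op := +%R)); first exact: add_continuous.
move=> i _ q.
apply: (@continuous_comp 'rV[R]_n.+1 R R (dotp (gamma i))
  (fun s => Num.max 0 (mu i * (1 - expR s)))); first exact: dotp_continuous.
apply: (@continuous_max R R (cst 0) (fun s => mu i * (1 - expR s))).
  exact: cst_continuous.
apply: cvgM; first exact: cvg_cst.
by apply: cvgB; [exact: cvg_cst|exact: continuous_expR].
Qed.

Lemma hamR_lt0_near p : hamR lam c mu p < 0 ->
  exists2 d : R, 0 < d & forall q, `|q - p| <= d -> hamR lam c mu q < 0.
Proof.
move=> hp; have /nbhs_ballP[d /= d0 hd] :
    nbhs p (hamR lam c mu @^-1` [set t | t < 0]).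
  by apply: hamR_continuous; exact: lt_nbhsl.
exists (d / 2); first by rewrite divr_gt0.
move=> q qp; apply: hd; rewrite -ball_normE/= distrC; lra.
Qed.

Lemma small_radius x : domG z x -> exists2 r : R, 0 < r & forall y,
  `|y - x| <= r -> y 0 ord0 <= z 0 ord0 - (z 0 ord0 - x 0 ord0) / 2 /\
  forall i, y 0 i = 0 -> x 0 i = 0.
Proof.
move=> [/andP[_ xz] _].
pose m i : R := if x 0 i == 0 then 1 else `|x 0 i| / 2.
have m0 i : 0 < m i.
  by rewrite /m; case: eqVneq => // xi; rewrite divr_gt0// normr_gt0.
exists (\big[Num.min/(z 0 ord0 - x 0 ord0) / 2]_i m i).
  elim/big_ind: _ => [|a b a0 b0|i _//]; last by rewrite lt_min a0.
  by rewrite divr_gt0// subr_gt0.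
move=> y yr; split=> [|i yi].
  have := le_trans (coord_le_norm (y - x) ord0) yr.
  have : \big[Num.min/(z 0 ord0 - x 0 ord0) / 2]_i m i <= (z 0 ord0 - x 0 ord0) / 2.
    exact: bigmin_le_id.
  by rewrite !mxE ler_norml; lra.
apply/eqP; rewrite -[_ == 0]negbK; apply/negP => xi.
have : \big[Num.min/(z 0 ord0 - x 0 ord0) / 2]_i m i <= m i by exact: bigmin_le_cond.
have := le_trans (coord_le_norm (y - x) i) yr.
rewrite /m (negbTE xi) !mxE yi sub0r normrN => h1 h2.
have : 0 < `|x 0 i| by rewrite normr_gt0.
lra.
Qed.

(** If both alternatives fail, maximising [phi - p] with a cone penalty near [x] yields a point [y]
    where the gradient of [phi] is close to [p]. There H is positive by construction of [phi] and
    negative by continuity. *)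
Lemma minV_Dplus x p : 0 < lam -> 0 < c -> (forall i, 0 < mu i) ->
  (forall i, 0 < z 0 i) ->
  (forall i, positive_solution lam c (mu i) (beta i)) ->
  domG z x -> Dplus z (minV beta z) x p ->
  0 <= hamR lam c mu p \/ exists2 i, x 0 i = 0 & 0 <= dotp p (gamma i).
Proof.
move=> lam0 c0 mu0 z0 bs xG /(DplusP z0) xp.
have [|Hneg] := leP 0 (hamR lam c mu p); first by left.
right; apply/not_exists2P => gneg.
have {}gneg i : x 0 i = 0 -> dotp p (gamma i) < 0.
  by move=> xi; have [//|] := gneg i; move/negP; rewrite -ltNge.
have [d1 d10 Hnear] := hamR_lt0_near Hneg.
pose d := d1 / 2; have d0 : 0 < d by rewrite divr_gt0.
have [r1 r10 hr1] := xp d d0.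
have [r2 r20 hr2] := small_radius xG.
pose r := Num.min (r1 / 2) r2.
have r0 : 0 < r by rewrite lt_min divr_gt0.
have rr1 : r < r1 by have : r <= r1 / 2 by [rewrite ge_min lexx]; lra.
have rr2 : r <= r2 by rewrite ge_min lexx orbT.
have xb : box z x.
  move=> i; have [->|i0] := eqVneq i ord0; last exact: xG.2.
  by case/andP: xG.1 => -> /ltW.
have xz0 : x 0 ord0 < z 0 ord0 by case/andP: xG.1.
have t0 : 0 < (z 0 ord0 - x 0 ord0) / 2 by lra.
(* On the sphere of radius [r] the penalty wins over the expansion of V by [d * r], and the two
   approximation errors use only half of it; so the maximum is interior to the ball. *)
have ze0 : 0 < d * r / 4 by rewrite divr_gt0// mulr_gt0.
(* With this slope a maximum on a face [y 0 i = z 0 i] would force [p 0 i <= - |p| - d]. *)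
have L0 : 0 <= `|p| + 3 * d by rewrite addr_ge0// mulr_ge0// ltW.
have [phi [D [cphi [C C0 [r3 r30 phiq]] phiV phiD]]] :=
  strict_subsolution_approximation lam0 c0 mu0 z0 bs L0 t0 ze0.
pose f y := phi y - dotp p y - 2 * d * `|y - x|.
pose B := box z `&` closed_ball x r.
have cB : compact B.
  by apply: compact_closedI; [exact: box_compact|exact: closed_ball_closed].
have BE y : B y <-> box z y /\ `|y - x| <= r.
  by rewrite /B closed_ballE// /closed_ball_ /= distrC.
have xB : B x by apply/BE; rewrite subrr normr0; split=> //; exact: ltW.
have cf : {within B, continuous f}.
  apply: continuous_subspaceT => y.
  apply: (@continuousB R R^o 'rV[R]_n.+1 (fun y => phi y - dotp p y)
    (fun y => 2 * d * `|y - x|)).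
    apply: (@continuousB R R^o 'rV[R]_n.+1 phi (dotp p)); first exact: cphi.
    exact: dotp_continuous.
  apply: (@continuousM R 'rV[R]_n.+1); first exact: cst_continuous.
  apply: (@continuous_comp 'rV[R]_n.+1 'rV[R]_n.+1 R (fun y => y - x) Num.norm).
    apply: (@continuousB R 'rV[R]_n.+1 'rV[R]_n.+1 id (cst x)).
      exact: cvg_id.
    exact: cst_continuous.
  exact: norm_continuous.
have [y] := compact_EVT_max (ex_intro _ x xB) cB cf.
rewrite inE => /BE[yb yr] ymax.
have {}ymax t : box z t -> `|t - x| <= r -> f t <= f y.
  by move=> tb tr; apply: ymax; rewrite inE; apply/BE.
have yr' : `|y - x| < r.
  rewrite lt_neqAle yr andbT; apply/negP => /eqP yE.
  have := ymax x xb; rewrite subrr normr0 => /(_ (ltW r0)).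
  have := hr1 y yb; rewrite yE => /(_ rr1).
  have := phiV y yb; have := phiV x xb.
  rewrite /f yE subrr normr0 !ler_norml dotpBr.
  have : 0 < d * r by rewrite mulr_gt0.
  lra.
have [yt yI] := hr2 y (le_trans yr rr2).
have [Hpos gpos top] := phiD y yb yt.
(* First-order condition along a feasible coordinate direction; the penalty has slope at most
   [2 * d]. *)
have key i (s b : R) : 0 < b -> `|s| = 1 ->
    (forall h, 0 < h <= b -> box z (y + (h * s) *: unitv i)) ->
    s * (D y 0 i - p 0 i) <= 2 * d.
  move=> b0 s1 hb; apply/ler_addgt0Pr => e e0.
  pose h := Num.min b (Num.min r3 (Num.min (r - `|y - x|) (e / (C + 1)))).
  have C1 : 0 < C + 1 by lra.
  have h0 : 0 < h by rewrite !lt_min b0 r30 subr_gt0 yr' divr_gt0.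
  have hB : h <= b by rewrite !ge_min lexx.
  have hr3 : h <= r3 by rewrite !ge_min lexx !orbT.
  have hr : h <= r - `|y - x| by rewrite !ge_min lexx !orbT.
  have hC : h <= e / (C + 1) by rewrite !ge_min lexx !orbT.
  have nh : `|(h * s) *: unitv i : 'rV[R]_n.+1| = h.
    by rewrite norm_scale_unitv normrM s1 mulr1 gtr0_norm.
  have h0b : 0 < h <= b by rewrite h0.
  have tx : `|y + (h * s) *: unitv i - x| <= `|y - x| + h.
    by rewrite addrAC -[in leRHS]nh ler_normD.
  have := ymax _ (hb h h0b) (le_trans tx _); rewrite -lerBrDl => /(_ hr).
  have := phiq y ((h * s) *: unitv i); rewrite nh => /(_ hr3).
  rewrite /f dotpDr !dotpZr !dotp_unitv => h1 h2.
  have h3 : 2 * d * `|y + (h * s) *: unitv i - x| <= 2 * d * (`|y - x| + h).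
    by rewrite ler_pM2l// mulr_gt0.
  have h4 : C * h <= e.
    have : h * (C + 1) <= e by rewrite -ler_pdivlMr.
    nra.
  have : h * (s * (D y 0 i - p 0 i)) <= h * (2 * d + C * h) by lra.
  rewrite ler_pM2l//; lra.
have ylt i : y 0 i < z 0 i.
  have [->|i0] := eqVneq i ord0; first by lra.
  have /andP[yi0 yi] := yb i; rewrite lt_neqAle yi andbT; apply/negP => /eqP yiE.
  have := top i i0 yiE.
  have := key i (-1) (z 0 i) (z0 i); rewrite normrN1 => /(_ erefl).
  move=> /(_ _)/wrap[] => [h /andP[h0 hz] j|].
    rewrite coord_add_unitv; have [->|ji] := eqVneq j i.
      by rewrite mulr1 yiE; lra.
    by rewrite mulr0 addr0; exact: yb.
  have := coord_le_norm p i; rewrite ler_norml; lra.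
have up i : D y 0 i - p 0 i <= 2 * d.
  have zy : 0 < z 0 i - y 0 i by rewrite subr_gt0.
  have := key i 1 _ zy (normr1 _); rewrite mul1r; apply=> h /andP[h0 hz] j.
  rewrite coord_add_unitv mulr1; have [->|ji] := eqVneq j i.
    by rewrite mulr1; have := yb i; lra.
  by rewrite mulr0 addr0; exact: yb.
have down i : y 0 i != 0 -> p 0 i - D y 0 i <= 2 * d.
  move=> yi; have yi0 : 0 < y 0 i by rewrite lt_neqAle eq_sym yi; case/andP: (yb i).
  have := key i (-1) _ yi0; rewrite normrN1 => /(_ erefl).
  move=> /(_ _)/wrap[] => [h /andP[h0 hz] j|]; last by lra.
  rewrite coord_add_unitv; have [->|ji] := eqVneq j i.
    by rewrite mulr1; have := yb i; lra.
  by rewrite mulr0 addr0; exact: yb.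
(* Only coordinates with [y 0 k = 0] can fail. At the last failing one, [p - D y] has a positive
   product with [gamma k], against [gneg] and [gpos]. *)
have close i : p 0 i - D y 0 i <= 2 * d.
  rewrite leNgt; apply/negP => qi.
  have [k qk kmax] := arg_maxnP (P := fun j => 2 * d < p 0 j - D y 0 j) val qi.
  have yk : y 0 k = 0.
    by apply/eqP; rewrite -[_ == 0]negbK; apply/negP => /down; rewrite leNgt qk.
  have := gneg k (yI k yk); have := gpos k yk; rewrite !dotp_gamma.
  case: ifP => kn; last by lra.
  have : p 0 (inord k.+1) - D y 0 (inord k.+1) <= 2 * d.
    by rewrite leNgt; apply/negP => /kmax /=; rewrite inordK// ltnn.
  lra.
have : `|D y - p| <= d1.
  apply: norm_le_coord; first exact: ltW.
  move=> i; rewrite !mxE ler_norml.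
  by have := up i; have := close i; rewrite /d; lra.
by move=> /Hnear; rewrite ltNge (ltW Hpos).
Qed.

End MinPlanesDplus.

Section Existence.
Context {R : realType} {n : nat}.
Variables (lam c : R) (mu beta : 'I_n.+1 -> R) (z : 'rV[R]_n.+1).

Lemma minV_continuous : continuous (minV beta z).
Proof.
move=> x s /(nbhs_ballP (minV beta z x))[e /= e0 es].
pose K := \sum_i \sum_j `|bvec beta i 0 j|.
have K0 : 0 <= K by apply: sumr_ge0 => i _; apply: sumr_ge0 => j _.
have K1 : 0 < K + 1 by lra.
apply/nbhs_ballP; exists (e / (K + 1)); first exact: divr_gt0.
move=> y; rewrite -ball_normE/= ltr_pdivlMr// mulrC => xy.
apply: es; rewrite -ball_normE/= (le_lt_trans (minV_lipschitz _ _ _ _))//.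
by rewrite (le_lt_trans _ xy)// ler_wpM2r// lerDl.
Qed.

Lemma minV_lipschitz_viscosity_solution :
  0 < lam -> 0 < c -> (forall i, 0 < mu i) -> (forall i, 0 < z 0 i) ->
  (forall i, positive_solution lam c (mu i) (beta i)) ->
  lipschitz_viscosity_solution lam c mu z (minV beta z).
Proof.
move=> lam0 c0 mu0 z0 bs.
have b0 i : 0 < beta i by exact: (bs i).1.
split.
  rewrite closure_domG//.
  have [x xb] := box_nonempty z0.
  apply: (@klipschitzW _ _ _ (\sum_i \sum_j `|bvec beta i 0 j|)).
    exact: (@globally_properfilter _ _ (x, x)).
  by move=> [u v] _ /=; exact: minV_lipschitz.
split.
- by apply: continuous_subspaceT; exact: minV_continuous.
- move=> x p xG /(minV_Dplus lam0 c0 mu0 z0 bs xG); rewrite Ham_hamR// le_max.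
  case=> [h|[i xi pi]]; apply/orP; [left|right]; first by rewrite lee_fin.
  apply: (@le_trans _ _ (dotp p (gamma i))%:E); first by rewrite lee_fin.
  by apply: le_bigmax_cond; rewrite inE xi.
- move=> x p xG /(minV_Dminus z0 lam0 mu0 bs xG); rewrite Ham_hamR// ge_min.
  case=> [h|[i xi pi]]; apply/orP; [left|right]; first by rewrite lee_fin.
  apply: (@le_trans _ _ (dotp p (gamma i))%:E); last by rewrite lee_fin.
  exact: bigmin_le_cond.
- move=> x [x0 xz]; apply/eqP; rewrite eq_le; apply/andP; split.
    by apply: le_trans (minV_le_ord0 _ _ _) _; rewrite x0 subrr mulr0.
  apply: minV_ge0 => // i; have [->|i0] := eqVneq i ord0; last exact: xz.
  by rewrite x0 lexx ltW.
Qed.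

End Existence.

Unset Implicit Arguments.

Theorem theorem2 (R : realType) (n : nat) (lam c : R) (mu : 'I_n.+1 -> R)
    (z : 'rV[R]_n.+1)
    (lam_gt0 : 0 < lam) (mu_gt0 : forall i, 0 < mu i)
    (z_gt0 : forall i, 0 < z 0 i) (c_gt0 : 0 < c) :
  (forall i, exists! b : R, positive_solution lam c (mu i) b) /\
  (forall beta : 'I_n.+1 -> R,
     (forall i, positive_solution lam c (mu i) (beta i)) ->
     lipschitz_viscosity_solution lam c mu z (minV beta z) /\
     (forall W : 'rV[R]_n.+1 -> R,
        lipschitz_viscosity_solution lam c mu z W ->
        forall x, closure (domG z) x -> W x = minV beta z x)).
Proof.
split=> [i|beta bs]; first exact: positive_solution_exists_unique.
split; first exact: minV_lipschitz_viscosity_solution.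
move=> W [lipW [cW sub super W0]] x; move: lipW cW.
rewrite closure_domG// => lipW cW xb; apply/eqP; rewrite eq_le; apply/andP; split.
  exact: (subsolution_le_minV lam_gt0 c_gt0).
(* Lipschitz continuity holds for all large constants; a positive one is extracted. *)
have [K K0 WK] := pinfty_ex_gt0 lipW.
apply: (supersolution_ge_minV (K := K) lam_gt0 c_gt0) super W0 _ xb => //.
  exact: ltW.
by move=> u v ub vb; exact: (WK (u, v) (conj ub vb)).
Qed.
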